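(* Let $H$ be a Hopf algebra over a field $k$ which is left noetherian. (1) If $H$ satisfies (FF), then $H$ is of $S$-finite type; consequently $\dim_k H$ is countable. (2) If $H$ satisfies (FF) and $H$ is locally affine, then $H$ is affine. (3) If $H$ is pointed, then $H$ is affine.
   Context: $k$ is algebraically closed of characteristic zero. $S$ denotes the antipode. $H$ is affine if it is finitely generated as a $k$-algebra. $H$ is locally affine if every finite subset of $H$ is contained in an affine Hopf subalgebra of $H$. $H$ is of $S$-finite type if there is a finite-dimensional subspace $V\subseteq H$ such that $H$ is generated as an algebra by $\bigcup_{i\ge0}S^i(V)$. $H$ satisfies (FF) if for every Hopf subalgebra $K\subseteq H$, $H$ is faithfully flat both as a right $K$-module and as a left $K$-module. Pointed means all simple subcoalgebras are one-dimensional. *)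

(* Defs.v *)
From HB Require Import structures.
From mathcomp Require Import all_boot all_order all_algebra.
Set Implicit Arguments. Unset Strict Implicit. Unset Printing Implicit Defensive.
Import GRing.Theory.
Local Open Scope ring_scope.

(* Hopf algebras over a field k, possibly infinite dimensional.
   H is a k-algebra (algType k).  The tensor product H (x)_k H is encoded by
   finite lists of pairs (representatives of sums of simple tensors); two
   representatives are equal in H (x) H iff every k-bilinear form takes the
   same value on them (valid over a field).  Subsets of H are predicates
   H -> Prop. *)

Section Hopf.
Variables (k : fieldType) (H : algType k).

Definition bilinear_form (f : H -> H -> k) :=
  (forall c x y z, f (c *: x + y) z = c * f x z + f y z) /\
  (forall c x y z, f z (c *: x + y) = c * f z x + f z y).

Definition teq (s t : seq (H * H)) :=
  forall f, bilinear_form f ->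
    \sum_(p <- s) f p.1 p.2 = \sum_(p <- t) f p.1 p.2.

Definition trilinear_form (f : H -> H -> H -> k) :=
  (forall c x y a b, f (c *: x + y) a b = c * f x a b + f y a b) /\
  (forall c x y a b, f a (c *: x + y) b = c * f a x b + f a y b) /\
  (forall c x y a b, f a b (c *: x + y) = c * f a b x + f a b y).

Definition teq3 (s t : seq (H * H * H)) :=
  forall f, trilinear_form f ->
    \sum_(p <- s) f p.1.1 p.1.2 p.2 = \sum_(p <- t) f p.1.1 p.1.2 p.2.

Record is_hopf (D : H -> seq (H * H)) (e : H -> k) (S : H -> H) : Prop := {
  D_lin : forall c x y,
    teq (D (c *: x + y)) ([seq (c *: p.1, p.2) | p <- D x] ++ D y);
  D_coass : forall h,
    teq3 (flatten [seq [seq (q.1, q.2, p.2) | q <- D p.1] | p <- D h])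
         (flatten [seq [seq (p.1, q.1, q.2) | q <- D p.2] | p <- D h]);
  e_lin : forall c x y, e (c *: x + y) = c * e x + e y;
  counit_l : forall h, \sum_(p <- D h) e p.1 *: p.2 = h;
  counit_r : forall h, \sum_(p <- D h) e p.2 *: p.1 = h;
  D_mul : forall x y,
    teq (D (x * y)) [seq (p.1 * q.1, p.2 * q.2) | p <- D x, q <- D y];
  D_one : teq (D 1) [:: (1, 1)];
  e_mul : forall x y, e (x * y) = e x * e y;
  e_one : e 1 = 1;
  S_lin : forall c x y, S (c *: x + y) = c *: S x + S y;
  antipode_l : forall h, \sum_(p <- D h) S p.1 * p.2 = e h *: 1;
  antipode_r : forall h, \sum_(p <- D h) p.1 * S p.2 = e h *: 1
}.

Inductive alg_gen (X : H -> Prop) : H -> Prop :=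
  | ag_in x : X x -> alg_gen X x
  | ag_one : alg_gen X 1
  | ag_add x y : alg_gen X x -> alg_gen X y -> alg_gen X (x + y)
  | ag_scale c x : alg_gen X x -> alg_gen X (c *: x)
  | ag_mul x y : alg_gen X x -> alg_gen X y -> alg_gen X (x * y).

Inductive span (X : H -> Prop) : H -> Prop :=
  | sp_zero : span X 0
  | sp_comb c x y : X x -> span X y -> span X (c *: x + y).

Definition affine := exists s : seq H, forall h, alg_gen (fun x => x \in s) h.

Definition countable_dim := exists f : nat -> H,
  forall h, span (fun x => exists n, x = f n) h.

Definition left_ideal (I : H -> Prop) :=
  I 0 /\ (forall x y, I x -> I y -> I (x + y)) /\ (forall h x, I x -> I (h * x)).

Definition left_noetherian := forall I : nat -> H -> Prop,
  (forall n, left_ideal (I n)) -> (forall n x, I n x -> I n.+1 x) ->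
  exists N, forall n x, (N <= n)%N -> I n x -> I N x.

Definition is_subspace (C : H -> Prop) :=
  C 0 /\ (forall c x y, C x -> C y -> C (c *: x + y)).

Section WithHopf.
Variables (D : H -> seq (H * H)) (S : H -> H).

Definition D_in (C1 C2 : H -> Prop) (h : H) :=
  exists t : seq (H * H), (forall p, p \in t -> C1 p.1 /\ C2 p.2) /\ teq (D h) t.

Definition hopf_sub (K : H -> Prop) :=
  [/\ is_subspace K, K 1, (forall x y, K x -> K y -> K (x * y)),
      (forall x, K x -> K (S x)) & (forall x, K x -> D_in K K x)].

Definition lmod_over (K : H -> Prop) (N : zmodType) (act : H -> N -> N) :=
  [/\ (forall x n m, K x -> act x (n + m) = act x n + act x m),
      (forall x y n, K x -> K y -> act (x + y) n = act x n + act y n),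
      (forall x y n, K x -> K y -> act (x * y) n = act x (act y n)) &
      (forall n, act 1 n = n)].

Definition rmod_over (K : H -> Prop) (N : zmodType) (act : N -> H -> N) :=
  [/\ (forall x n m, K x -> act (n + m) x = act n x + act m x),
      (forall x y n, K x -> K y -> act n (x + y) = act n x + act n y),
      (forall x y n, K x -> K y -> act n (x * y) = act (act n x) y) &
      (forall n, act n 1 = n)].

Definition lmod_map (K : H -> Prop) (N N' : zmodType)
  (act : H -> N -> N) (act' : H -> N' -> N') (g : N -> N') :=
  (forall n m, g (n + m) = g n + g m) /\ (forall x n, K x -> g (act x n) = act' x (g n)).

Definition rmod_map (K : H -> Prop) (N N' : zmodType)
  (act : N -> H -> N) (act' : N' -> H -> N') (g : N -> N') :=
  (forall n m, g (n + m) = g n + g m) /\ (forall x n, K x -> g (act n x) = act' (g n) x).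

(* sum of the simple tensors in s is zero in H (x)_K N  (H a right K-module) *)
Definition tz_HN (K : H -> Prop) (N : zmodType) (act : H -> N -> N)
  (s : seq (H * N)) :=
  forall (A : zmodType) (f : H -> N -> A),
    (forall x y n, f (x + y) n = f x n + f y n) ->
    (forall x n m, f x (n + m) = f x n + f x m) ->
    (forall x a n, K a -> f (x * a) n = f x (act a n)) ->
    \sum_(p <- s) f p.1 p.2 = 0.

(* sum of the simple tensors in s is zero in N (x)_K H  (H a left K-module) *)
Definition tz_NH (K : H -> Prop) (N : zmodType) (act : N -> H -> N)
  (s : seq (N * H)) :=
  forall (A : zmodType) (f : N -> H -> A),
    (forall n x y, f n (x + y) = f n x + f n y) ->
    (forall n m x, f (n + m) x = f n x + f m x) ->
    (forall n a x, K a -> f (act n a) x = f n (a * x)) ->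
    \sum_(p <- s) f p.1 p.2 = 0.

Definition ff_right (K : H -> Prop) :=
  (forall (N N' : zmodType) (act : H -> N -> N) (act' : H -> N' -> N')
          (g : N -> N'),
     lmod_over K act -> lmod_over K act' -> lmod_map K act act' g -> injective g ->
     forall s : seq (H * N),
       tz_HN K act' [seq (p.1, g p.2) | p <- s] -> tz_HN K act s) /\
  (forall (N : zmodType) (act : H -> N -> N), lmod_over K act ->
     (forall h n, tz_HN K act [:: (h, n)]) -> forall n : N, n = 0).

Definition ff_left (K : H -> Prop) :=
  (forall (N N' : zmodType) (act : N -> H -> N) (act' : N' -> H -> N')
          (g : N -> N'),
     rmod_over K act -> rmod_over K act' -> rmod_map K act act' g -> injective g ->
     forall s : seq (N * H),
       tz_NH K act' [seq (g p.1, p.2) | p <- s] -> tz_NH K act s) /\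
  (forall (N : zmodType) (act : N -> H -> N), rmod_over K act ->
     (forall n h, tz_NH K act [:: (n, h)]) -> forall n : N, n = 0).

Definition FF := forall K, hopf_sub K -> ff_right K /\ ff_left K.

Definition S_finite_type := exists s : seq H,
  forall h, alg_gen (fun x => exists (i : nat) (v : H),
                         span (fun y => y \in s) v /\ x = iter i S v) h.

Definition locally_affine := forall s : seq H, exists K,
  [/\ hopf_sub K, (forall x, x \in s -> K x) &
      exists t : seq H, (forall x, x \in t -> K x) /\
                        forall x, K x -> alg_gen (fun y => y \in t) x].

Definition subcoalgebra (C : H -> Prop) :=
  is_subspace C /\ forall x, C x -> D_in C C x.

Definition simple_subcoalgebra (C : H -> Prop) :=
  [/\ subcoalgebra C, (exists x, C x /\ x != 0) &
      forall C', subcoalgebra C' -> (forall x, C' x -> C x) ->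
        (forall x, C' x -> x = 0) \/ (forall x, C x -> C' x)].

Definition one_dim (C : H -> Prop) :=
  exists x, x != 0 /\ forall y, C y <-> exists c : k, y = c *: x.

Definition pointed := forall C, simple_subcoalgebra C -> one_dim C.

End WithHopf.
End Hopf.

(* Main.v *)
(* Sending a Hopf subalgebra K to the left ideal HK^+ is injective as soon as
   [1 (x) x = x (x) 1] in [H (x)_K H] forces [x] into K, because
   [H (x)_K H ~ H/HK^+ (x) H]; then left noetherianity gives the ascending chain
   condition on Hopf subalgebras.  A maximal Hopf subalgebra generated by the
   antipode orbit of a finite-dimensional subcoalgebra (resp. a maximal affine
   one) is all of H.  The condition on K follows from faithful flatness.  For
   pointed H it follows from a K-linear retraction H -> K: a nonzero H-comodule
   contains a weight vector m, and m generates a free K-module [m K] in every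
   quotient Hopf module of H.  Pointed H is locally affine, since a
   finite-dimensional subcoalgebra C and the inverses of its grouplikes generate
   an algebra containing S(C). *)
Require Import Defs.
From HB Require Import structures.
From mathcomp Require Import all_boot all_order all_algebra.
From mathcomp Require Import boolp classical_sets.
Set Implicit Arguments. Unset Strict Implicit. Unset Printing Implicit Defensive.
Import GRing.Theory.
Local Open Scope ring_scope.

(** Tensor products are never constructed. An equality in H (x)_K H means that all K-balanced maps
    into abelian groups take equal values, whereas the Hopf axioms only control k-valued forms;
    [teq_tensor_eq] bridges the two. Membership of a tensor in C1 (x) C2 is tested on its slices by
    linear functionals, so coideals and comodules become subspaces stable under operators. Of the
    canonical isomorphism only the direction from H/HK^+ (x) H to H (x)_K H is used. Finite
    dimension is expressed by finite generating lists, whose lengths replace dimension counts. *)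

Lemma zorn_above T (P : (T -> Prop) -> Prop) (A0 : T -> Prop) : P A0 ->
  (forall F : (T -> Prop) -> Prop, (exists A, F A) -> (forall A, F A -> P A) ->
     (forall A B, F A -> F B -> (forall x, A x -> B x) \/ (forall x, B x -> A x)) ->
     P (fun x => exists2 A, F A & A x)) ->
  exists A, [/\ P A, (forall x, A0 x -> A x) &
    forall B, P B -> (forall x, A x -> B x) -> forall x, B x -> A x].
Proof.
move=> PA0 chain.
(* [Zorn_bigcup] also ranges over the empty chain, whose union is empty. Joining [A0] to every set
   turns that union into [A0] and makes [A0] a lower bound. *)
pose Q (X : set T) := P (fun x => A0 x \/ X x).
have [F FQ Ftot|A [QA maxA]] := @Zorn_bigcup T Q.
  have [[X0 FX0]|F0] := pselect (exists X, F X); last first.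
    rewrite /Q; set U := (fun x => _).
    suff -> : U = A0 by [].
    apply/funext => x; apply/propext; split; last by left.
    by case=> // -[X FX _]; case: F0; exists X.
  pose G (Y : T -> Prop) := exists2 X, F X & Y = (fun x => A0 x \/ X x).
  have := chain G; rewrite /Q; set U := (fun x => exists2 _, _ & _).
  set U' := (fun x => _ \/ _).
  have -> : U = U'.
    apply/funext => x; apply/propext; split.
      by case=> _ [X FX ->] [?|Xx]; [left|right; exists X].
    case=> [A0x|[X FX Xx]].
      by exists (fun x => A0 x \/ X0 x); [exists X0|left].
    by exists (fun x => A0 x \/ X x); [exists X|right].
  apply.
  - by exists (fun x => A0 x \/ X0 x); exists X0.
  - by move=> _ [X FX ->]; apply: FQ.
  - move=> _ _ [X FX ->] [Y FY ->].
    by case: (Ftot X Y FX FY) => s; [left|right] => x [?|?]; auto.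
exists (fun x => A0 x \/ A x); split=> //; first by left.
move=> B PB AB x Bx; right; apply: contrapT => nAx.
apply: (maxA B); last first.
  rewrite /Q; set U := (fun x => _); suff -> : U = B by [].
  apply/funext => y; apply/propext; split; last by right.
  by case=> ?; auto.
split; last by move=> /(_ x Bx).
by move=> y Ay; apply: AB; right.
Qed.

(** * Linear algebra *)

Section LinearAlgebra.
Variable k : fieldType.

Definition lin (V W : lmodType k) (f : V -> W) :=
  forall c x y, f (c *: x + y) = c *: f x + f y.

Definition subsp (V : lmodType k) (C : V -> Prop) :=
  C 0 /\ forall c x y, C x -> C y -> C (c *: x + y).

Section Lin.
Variables (V W : lmodType k) (f : V -> W).
Hypothesis lf : lin f.

Lemma lin0 : f 0 = 0.
Proof.
have /eqP := lf 1 0 0; rewrite !scale1r addr0.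
by rewrite -[X in X == _]addr0 (inj_eq (addrI _)) => /eqP.
Qed.

Lemma linD x y : f (x + y) = f x + f y.
Proof. by have := lf 1 x y; rewrite !scale1r. Qed.

Lemma linZ c x : f (c *: x) = c *: f x.
Proof. by have := lf c x 0; rewrite !addr0 lin0 addr0. Qed.

Lemma linN x : f (- x) = - f x.
Proof. by rewrite -scaleN1r linZ scaleN1r. Qed.

Lemma linB x y : f (x - y) = f x - f y.
Proof. by rewrite linD linN. Qed.

Lemma lin_suml I (r : seq I) (F : I -> V) :
  f (\sum_(i <- r) F i) = \sum_(i <- r) f (F i).
Proof. by elim: r => [|a r IH]; rewrite ?big_nil ?lin0 // !big_cons linD IH. Qed.

End Lin.

Section Subsp.
Variables (V : lmodType k) (C : V -> Prop).
Hypothesis sC : subsp C.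

Lemma subsp0 : C 0. Proof. by case: sC. Qed.

Lemma subspZ c x : C x -> C (c *: x).
Proof. by case: sC => C0 CP Cx; rewrite -[_ *: _]addr0; apply: CP. Qed.

Lemma subspD x y : C x -> C y -> C (x + y).
Proof. by case: sC => C0 CP Cx Cy; rewrite -[x]scale1r; apply: CP. Qed.

Lemma subspN x : C x -> C (- x).
Proof. by move=> Cx; rewrite -scaleN1r; apply: subspZ. Qed.

Lemma subspB x y : C x -> C y -> C (x - y).
Proof. by move=> Cx Cy; apply: subspD => //; apply: subspN. Qed.

Lemma subsp_sum (I : eqType) (r : seq I) (F : I -> V) :
  (forall i, i \in r -> C (F i)) -> C (\sum_(i <- r) F i).
Proof.
elim: r => [|a r IH] CF; first by rewrite big_nil; apply: subsp0.
rewrite big_cons; apply: subspD; first by apply: CF; rewrite mem_head.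
by apply: IH => i ir; apply: CF; rewrite inE ir orbT.
Qed.

End Subsp.

Lemma subsp_preim (V W : lmodType k) (f : V -> W) (C : W -> Prop) :
  lin f -> subsp C -> subsp (fun x => C (f x)).
Proof.
move=> lf sC; split; first by rewrite (lin0 lf); apply: subsp0.
by move=> c x y Cx Cy; rewrite lf; case: sC => _; apply.
Qed.

Lemma subspI (V : lmodType k) (C C' : V -> Prop) :
  subsp C -> subsp C' -> subsp (fun x => C x /\ C' x).
Proof.
move=> sC sC'; split; first by split; apply: subsp0.
by move=> c x y [? ?] [? ?]; case: sC => _ sC; case: sC' => _ sC'; split; auto.
Qed.

Lemma subsp_chain (V : lmodType k) (F : (V -> Prop) -> Prop) :
  (exists A, F A) -> (forall A, F A -> subsp A) ->
  (forall A B, F A -> F B -> (forall x, A x -> B x) \/ (forall x, B x -> A x)) ->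
  subsp (fun x => exists2 A, F A & A x).
Proof.
move=> [A FA] Fs Ft; split; first by exists A => //; apply: subsp0; apply: Fs.
move=> c x y [X FX Xx] [Y FY Yy].
case: (Ft X Y FX FY) => s; [exists Y|exists X] => //.
  by case: (Fs Y FY) => _; apply; auto.
by case: (Fs X FX) => _; apply; auto.
Qed.

Lemma subsp_adjoin (V : lmodType k) (C : V -> Prop) v :
  subsp C -> subsp (fun x => exists c : k, C (x - c *: v)).
Proof.
move=> sC; split; first by exists 0; rewrite scale0r subr0; apply: subsp0.
move=> c x y [a Ca] [b Cb]; exists (c * a + b).
have -> : c *: x + y - (c * a + b) *: v = c *: (x - a *: v) + (y - b *: v).
  by rewrite scalerDl -scalerA scalerBr opprD addrACA.
by case: sC => _; apply.
Qed.

(** A subspace [U] maximal among those that contain [W] and avoid [v] is a hyperplane complementing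
    [v]; [phi] reads off the coefficient of [v] modulo [U]. *)
Lemma separating_functional (V : lmodType k) (W : V -> Prop) v :
  subsp W -> ~ W v ->
  exists phi : V -> k^o, [/\ lin phi, forall w, W w -> phi w = 0 & phi v = 1].
Proof.
move=> sW nWv.
have [F F0 FP Ft|U [[sU nUv] WU maxU]] :=
    @zorn_above V (fun U => subsp U /\ ~ U v) W (conj sW nWv).
  split; last by case=> A /FP[].
  by apply: subsp_chain => // A /FP[].
have complement y : exists c : k, U (y - c *: v).
  have [[c Uvc]|nU'v] := pselect (exists c : k, U (v - c *: y)).
    have c0 : c != 0.
      by apply/eqP => c0; apply: nUv; rewrite -[v](subr0) -(scale0r y) -c0.
    exists c^-1; rewrite -opprB; apply: (subspN sU).
    rewrite -[y](scale1r) -(mulVf c0) -scalerA -scalerBr.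
    exact: subspZ.
  exists 0; rewrite scale0r subr0.
  apply: (maxU (fun x => exists c : k, U (x - c *: y))); last first.
  - by exists 1; rewrite scale1r subrr; apply: subsp0.
  - by move=> x Ux; exists 0; rewrite scale0r subr0.
  - by split => //; apply: subsp_adjoin.
have uniq_c y c d : U (y - c *: v) -> U (y - d *: v) -> c = d.
  move=> Uc Ud; apply/eqP; rewrite -subr_eq0; apply/negPn/negP => cd0.
  apply: nUv; rewrite -[v]scale1r -(mulVf cd0) -scalerA; apply: subspZ => //.
  have := subspB sU Ud Uc.
  by rewrite opprB addrC subrKA scalerBl.
have [phi phiP] := choice complement.
exists phi; split.
- move=> c x y; apply: uniq_c (phiP _) _.
  have -> : c *: x + y - ((c * phi x : k) + phi y) *: v =
       c *: (x - phi x *: v) + (y - phi y *: v).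
    by rewrite scalerDl -scalerA scalerBr opprD addrACA.
  by case: sU => _; apply.
- move=> w Ww; apply: uniq_c (phiP _) _.
  by rewrite scale0r subr0; apply: WU.
- apply: uniq_c (phiP _) _; rewrite scale1r subrr; exact: subsp0.
Qed.

Lemma functionals_separate (V : lmodType k) (x y : V) :
  (forall phi : V -> k^o, lin phi -> phi x = phi y) -> x = y.
Proof.
move=> xy; apply: contrapT => nxy.
have s0 : subsp (fun z : V => z = 0).
  by split=> // c ? ? -> ->; rewrite scaler0 addr0.
have [|phi [lphi _ /eqP]] := separating_functional s0 (v := x - y).
  by move=> /eqP; rewrite subr_eq0 => /eqP.
by rewrite (linB lphi) (xy phi lphi) subrr eq_sym oner_eq0.
Qed.

Lemma mem_annihilator (V : lmodType k) (C : V -> Prop) x : subsp C ->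
  (forall phi : V -> k^o, lin phi -> (forall y, C y -> phi y = 0) -> phi x = 0) ->
  C x.
Proof.
move=> sC h; apply: contrapT => nCx.
have [phi [lphi phiC /eqP]] := separating_functional sC nCx.
by rewrite (h phi) // eq_sym oner_eq0.
Qed.

Section Adjoin.
Variable V : lmodType k.
Implicit Types (M N C : V -> Prop) (l : seq V).

(** The subspace M + span(l). The length of [l] bounds its dimension modulo [M]. *)
Fixpoint adj M l : V -> Prop :=
  if l is a :: l' then fun y => exists c : k, adj M l' (y - c *: a) else M.

Lemma subsp_adj M l : subsp M -> subsp (adj M l).
Proof. by move=> sM; elim: l => //= a l; apply: subsp_adjoin. Qed.

Lemma adj_sub M l x : M x -> adj M l x.
Proof. by elim: l => //= a l IH /IH h; exists 0; rewrite scale0r subr0. Qed.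

Lemma adj_gen M l x : subsp M -> x \in l -> adj M l x.
Proof.
move=> sM; elim: l => //= a l IH; rewrite inE => /orP[/eqP->|/IH h].
  by exists 1; rewrite scale1r subrr; apply: subsp0; apply: subsp_adj.
by exists 0; rewrite scale0r subr0.
Qed.

Lemma adj_min M N l : subsp N -> (forall x, M x -> N x) ->
  (forall x, x \in l -> N x) -> forall x, adj M l x -> N x.
Proof.
move=> sN MN; elim: l => //= a l IH lN x [c h].
rewrite -(subrK (c *: a) x); apply: subspD => //.
  by apply: IH h => y yl; apply: lN; rewrite inE yl orbT.
by apply: subspZ => //; apply: lN; rewrite mem_head.
Qed.

(** Monotonicity of dimension, phrased with generating lists; the last clause says that equal
    lengths leave no room for a proper subspace. In the induction, [N] needs one generator more than
    its intersection with [adj M l] exactly when it is not contained in it. *)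
Lemma adj_subspace M N l : subsp M -> subsp N ->
  (forall x, M x -> N x) -> (forall x, N x -> adj M l x) ->
  exists l', [/\ forall x, N x <-> adj M l' x, (size l' <= size l)%N &
    size l' = size l -> forall x, adj M l x -> N x].
Proof.
move=> sM; elim: l N => [|a l IH] N sN MN Nl.
  exists [::]; split=> // x; split; [exact: Nl|exact: MN].
have sMl := subsp_adj l sM.
have [|||l0 [N0P ls leq0]] := IH (fun x => N x /\ adj M l x).
- exact: subspI.
- by move=> x Mx; split; [apply: MN|apply: adj_sub].
- by move=> x [].
have [[y [Ny nly]]|Nsub] := pselect (exists y, N y /\ ~ adj M l y); last first.
  exists l0; split.
  - move=> x; split; last by move/N0P => [].
    move=> Nx; apply/N0P; split=> //; apply: contrapT => nx.
    by apply: Nsub; exists x.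
  - exact: leqW.
  - by move=> /= e; move: ls; rewrite e ltnn.
have [c yc] := Nl _ Ny.
have c0 : c != 0.
  by apply/eqP => c0; apply: nly; move: yc; rewrite c0 scale0r subr0.
exists (y :: l0); split=> /=.
- move=> z; split=> [Nz|[d /N0P[Nzd _]]]; last first.
    by rewrite -(subrK (d *: y) z); apply: subspD => //; apply: subspZ.
  have [d zd] := Nl _ Nz; exists (d / c); apply/N0P; split.
    by apply: subspB => //; apply: subspZ.
  have -> : z - (d / c) *: y = (z - d *: a) - (d / c) *: (y - c *: a).
    by rewrite scalerBr scalerA divfK // opprB addrA subrK.
  by apply: subspB => //; apply: subspZ.
- by rewrite ltnS.
move=> [/leq0 lN]; have {}lN x : adj M l x -> N x by move/lN => [].
move=> x [d h]; rewrite -(subrK (d *: a) x); apply: subspD => //; first exact: lN.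
apply: subspZ => //; rewrite -[a](scale1r) -(mulVf c0) -scalerA.
apply: subspZ => //; rewrite -[c *: a](subKr y); apply: subspB => //; exact: lN.
Qed.

(** Descent on the length of the list. It will provide simple subcoalgebras (with [M] zero) and
    simple subquotient comodules. *)
Lemma minimal_above (P : (V -> Prop) -> Prop) M N0 l :
  subsp M -> (forall N, P N -> subsp N) -> P N0 ->
  (forall x, M x -> N0 x) -> (exists2 x, N0 x & ~ M x) ->
  (forall x, N0 x -> adj M l x) ->
  exists N, [/\ P N, forall x, N x -> N0 x, forall x, M x -> N x,
    exists2 x, N x & ~ M x &
    forall N', P N' -> (forall x, M x -> N' x) -> (forall x, N' x -> N x) ->
      (forall x, N' x -> M x) \/ (forall x, N x -> N' x)].
Proof.
move=> sM Ps; have [n] := ubnP (size l).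
elim: n l N0 => // n IH l N0 ln PN0 MN0 exN0 N0l.
(* [l] may be longer than [N0] requires; [l0] generates exactly [N0] over [M], so a proper [N'] gets
   a strictly shorter list. *)
have [l0 [N0P l0l _]] := adj_subspace sM (Ps _ PN0) MN0 N0l.
pose smaller N' := [/\ P N', forall x, M x -> N' x, forall x, N' x -> N0 x,
  exists2 x, N' x & ~ M x & ~ (forall x, N0 x -> N' x)].
have [[N' [PN' MN' N'N0 exN' nN']]|none] := pselect (exists N', smaller N').
  have [|l' [N'P l'l0 leq']] := adj_subspace (l := l0) sM (Ps _ PN') MN'.
    by move=> x /N'N0/N0P.
  have l'lt : (size l' < n)%N.
    apply: leq_trans (leq_trans l0l _); last by rewrite -ltnS.
    rewrite ltn_neqAle l'l0 andbT; apply/eqP => /leq' h.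
    by apply: nN' => x /N0P/h.
  have [|N [PN NN' MN exN minN]] := IH l' N' l'lt PN' MN' exN'.
    by move=> x /N'P.
  by exists N; split=> // x /NN'/N'N0.
exists N0; split=> // N' PN' MN' N'N0.
have [|nN'] := pselect (forall x, N0 x -> N' x); first by right.
left=> x N'x; apply: contrapT => nMx; apply: none; exists N'; split=> //.
by exists x.
Qed.

End Adjoin.
End LinearAlgebra.

(** * Tensors *)

Section Tensors.
Variables (k : fieldType) (H : algType k).
Implicit Types (s t u : seq (H * H)) (C : H -> Prop).

Definition bilin (V : lmodType k) (F : H -> H -> V) :=
  (forall z, lin (fun x => F x z)) /\ (forall z, lin (F z)).

(** Targets are arbitrary abelian groups because the tensor products over [K] in the flatness
    conditions are tested on such maps. *)
Definition balanced (A : zmodType) (F : H -> H -> A) :=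
  [/\ forall x y z, F (x + y) z = F x z + F y z,
      forall z x y, F z (x + y) = F z x + F z y &
      forall (c : k) x y, F (c *: x) y = F x (c *: y)].

Lemma bilin_balanced (V : lmodType k) (F : H -> H -> V) : bilin F -> balanced F.
Proof.
move=> [F1 F2]; split=> [x y z|z x y|c x y].
- exact: (linD (F1 z)).
- exact: (linD (F2 z)).
- by rewrite (linZ (F1 y)) (linZ (F2 x)).
Qed.

Lemma balanced0l (A : zmodType) (F : H -> H -> A) y : balanced F -> F 0 y = 0.
Proof.
case=> F1 _ _; apply: (addrI (F 0 y)); by rewrite -F1 !addr0.
Qed.

Lemma balancedNl (A : zmodType) (F : H -> H -> A) x y :
  balanced F -> F (- x) y = - F x y.
Proof.
move=> bF; case: (bF) => F1 _ _; apply: (addrI (F x y)).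
by rewrite -F1 !subrr balanced0l.
Qed.

Definition tensor_eq s t := forall (A : zmodType) (F : H -> H -> A),
  balanced F -> \sum_(p <- s) F p.1 p.2 = \sum_(p <- t) F p.1 p.2.

Definition inC C1 C2 t := forall p : H * H, p \in t -> C1 p.1 /\ C2 p.2.

(** Independence of the second components, for the coefficient families that a functional on the
    first factor produces. *)
Definition free_snd t := forall phi : H -> k^o, lin phi ->
  \sum_(p <- t) phi p.1 *: p.2 = 0 -> forall p, p \in t -> phi p.1 = 0.

Fixpoint free_seq (l : seq H) : Prop :=
  if l is a :: l' then ~ adj (fun x => x = 0) l' a /\ free_seq l' else True.

Lemma subsp_zero (V : lmodType k) : subsp (fun x : V => x = 0).
Proof. by split=> // c x y -> ->; rewrite scaler0 addr0. Qed.

Lemma free_seq_snd t : free_seq [seq p.2 | p <- t] -> free_snd t.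
Proof.
elim: t => [|p t IH] //= [np ft] phi lphi; rewrite big_cons => eq0 q.
have s0 : subsp (adj (fun x => x = 0) [seq p.2 | p <- t]).
  exact/subsp_adj/subsp_zero.
have phip : phi p.1 = 0.
  apply/eqP/negPn/negP => c0; apply: np.
  rewrite -[p.2]scale1r -(mulVf c0) -scalerA; apply: subspZ => //.
  move/eqP: eq0; rewrite addr_eq0 => /eqP ->; apply: subspN => //.
  apply: subsp_sum => // r rt; apply: subspZ => //; apply: adj_gen.
    exact: subsp_zero.
  by apply: map_f.
rewrite inE => /orP[/eqP->//|qt].
by apply: IH qt => //; move: eq0; rewrite phip scale0r add0r.
Qed.

(** Writing y as a combination of the second components q_i with coefficients c_i, the tensor x (x)
    y is spread over the pairs by adding c_i x to their first components. *)
Lemma absorb C t x y : subsp C -> C x -> (forall p, p \in t -> C p.1) ->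
  adj (fun x => x = 0) [seq p.2 | p <- t] y ->
  exists t', [/\ [seq p.2 | p <- t'] = [seq p.2 | p <- t],
    forall p, p \in t' -> C p.1 & tensor_eq t' ((x, y) :: t)].
Proof.
move=> sC Cx; elim: t y => [|q t IH] y Ct /=.
  move=> ->; exists [::]; split=> // A F [F1 F2 F3].
  rewrite big_cons big_nil /= addr0.
  by apply: (addrI (F x 0)); rewrite -F2 !addr0.
move=> [c /IH[|t' [e Ct' tt']]]; first by move=> p pt; apply: Ct; rewrite inE pt orbT.
exists ((q.1 + c *: x, q.2) :: t'); split=> /=; first by rewrite e.
  move=> p; rewrite inE => /orP[/eqP-> /=|/Ct'//]; apply: subspD => //.
    by apply: Ct; rewrite mem_head.
  exact: subspZ.
move=> A F bF; rewrite !big_cons /= (tt' _ _ bF) big_cons /=.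
case: bF => F1 F2 F3; rewrite F1 F3 -addrA [RHS]addrCA; congr (_ + _).
by rewrite addrA -F2 [c *: _ + _]addrC subrK.
Qed.

Lemma reduce_snd C1 C2 t : subsp C1 -> inC C1 C2 t ->
  exists t', [/\ tensor_eq t' t, free_snd t' & inC C1 C2 t'].
Proof.
move=> sC Ct.
suff [t' [tt' ft' Ct1 Ct2]] : exists t', [/\ tensor_eq t' t,
    free_seq [seq p.2 | p <- t'], forall p, p \in t' -> C1 p.1 &
    forall p, p \in t' -> C2 p.2].
  exists t'; split=> //; first exact: free_seq_snd.
  by move=> p pt; split; auto.
elim: t Ct => [|p t IH] Ct; first by exists [::]; split.
have [|t' [tt' ft' Ct1 Ct2]] := IH.
  by move=> q qt; apply: Ct; rewrite inE qt orbT.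
have [Cp1 Cp2] := Ct p (mem_head _ _).
have [ad|nad] := pselect (adj (fun x => x = 0) [seq p.2 | p <- t'] p.2).
  have [t'' [e Ct'' tt'']] := absorb sC Cp1 Ct1 ad.
  exists t''; split=> //.
  - by move=> A F bF; rewrite (tt'' _ _ bF) !big_cons /= (tt' _ _ bF).
  - by rewrite e.
  - move=> q /(map_f snd); rewrite e => /mapP[r rt ->]; exact: Ct2.
exists (p :: t'); split=> //=.
- by move=> A F bF; rewrite !big_cons (tt' _ _ bF).
- by move=> q; rewrite inE => /orP[/eqP->|/Ct1].
- by move=> q; rewrite inE => /orP[/eqP->|/Ct2].
Qed.

Lemma tensor_eq_teq s t : tensor_eq s t -> teq s t.
Proof.
move=> st f [f1 f2]; apply: (st k f).
apply: (@bilin_balanced k^o); split=> z c x y; [exact: f1|exact: f2].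
Qed.

(** Represent the difference with independent second components. The forms phi(x) psi(y) vanish on
    it, so all its first components are zero and every balanced map kills it. *)
Lemma teq_tensor_eq s t : teq s t -> tensor_eq s t.
Proof.
move=> st A F bF.
pose u := s ++ [seq (- p.1, p.2) | p <- t].
have uE (B : zmodType) (G : H -> H -> B) : balanced G ->
    \sum_(p <- u) G p.1 p.2 = \sum_(p <- s) G p.1 p.2 - \sum_(p <- t) G p.1 p.2.
  move=> bG; rewrite big_cat /= big_map -sumrN; congr (_ + _).
  by apply: eq_bigr => p _ /=; rewrite (balancedNl _ _ bG).
have [u' [uu' fu' _]] : exists u', [/\ tensor_eq u' u, free_snd u' &
    inC (fun=> True) (fun=> True) u'] by apply: reduce_snd.
have z1 p : p \in u' -> p.1 = 0.
  move=> pu; apply: functionals_separate => phi lphi; rewrite (lin0 lphi).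
  apply: (fu' phi lphi _ p pu); apply: functionals_separate => psi lpsi.
  rewrite (lin0 lpsi) (lin_suml lpsi).
  pose G x y : k := phi x * psi y.
  have bG : bilinear_form G.
    split=> c x y z; rewrite /G; first by rewrite lphi mulrDl -mulrA.
    by rewrite lpsi mulrDr mulrCA.
  have bbG : balanced G.
    by apply: (@bilin_balanced k^o); case: bG => g1 g2; split=> z c x y; auto.
  transitivity (\sum_(p <- u') G p.1 p.2).
    by apply: eq_bigr => q _; rewrite (linZ lpsi).
  by rewrite (uu' _ _ bbG) (uE _ _ bbG) (st _ bG) subrr.
apply/eqP; rewrite -subr_eq0 -(uE _ _ bF) -(uu' _ _ bF); apply/eqP.
by rewrite big_seq big1 // => p /z1 ->; apply: balanced0l.
Qed.

Lemma teq_bilin (V : lmodType k) (F : H -> H -> V) s t :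
  teq s t -> bilin F -> \sum_(p <- s) F p.1 p.2 = \sum_(p <- t) F p.1 p.2.
Proof. by move=> /teq_tensor_eq st /bilin_balanced; apply: st. Qed.

Definition swap t := [seq (p.2, p.1) | p <- t].

Lemma tensor_eq_swap s t : tensor_eq s t -> tensor_eq (swap s) (swap t).
Proof.
move=> st A F [F1 F2 F3]; rewrite !big_map /=.
by apply: (st A (fun x y => F y x)); split=> // c x y; rewrite F3.
Qed.

Lemma swapK t : swap (swap t) = t.
Proof. by rewrite /swap -map_comp map_id_in // => -[]. Qed.

(* A tensor lies in [C (x) C2] as soon as its slices by functionals on the
   second factor lie in [C]: they determine the first components of a
   representative with independent second components. *)
Lemma slice_fst C1 C2 C t : subsp C -> subsp C1 -> inC C1 C2 t ->
  (forall f : H -> k^o, lin f -> C (\sum_(p <- t) f p.2 *: p.1)) ->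
  exists2 t', tensor_eq t' t & inC (fun x => C1 x /\ C x) C2 t'.
Proof.
move=> sC sC1 Ct h; have [t' [tt' ft' Ct']] := reduce_snd sC1 Ct.
exists t' => // p pt; have [? ?] := Ct' p pt; split=> //; split=> //.
apply: mem_annihilator => // phi lphi phiC; apply: ft' pt => //.
apply: functionals_separate => f lf; rewrite (lin0 lf) (lin_suml lf).
have bG : balanced (fun x y => f y *: phi x : k^o).
  apply: bilin_balanced; split=> z c x y.
    by rewrite lphi scalerDr !scalerA mulrC.
  by rewrite lf scalerDl scalerA.
transitivity (\sum_(p <- t') (f p.2 *: phi p.1 : k^o)).
  by apply: eq_bigr => q _; rewrite (linZ lf) [LHS]mulrC.
rewrite (tt' _ _ bG) /=; transitivity (phi (\sum_(p <- t) f p.2 *: p.1)).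
  by rewrite (lin_suml lphi); apply: eq_bigr => q _; rewrite (linZ lphi).
by apply: phiC; apply: h.
Qed.

End Tensors.

(** * Sweedler calculus *)

Section LinearRules.
Variables (k : fieldType) (H : algType k) (V W : lmodType k).

Lemma lin_id : lin (fun x : V => x). Proof. by []. Qed.

Lemma lin_comp (U : lmodType k) (f : V -> U) (g : W -> V) :
  lin f -> lin g -> lin (fun x => f (g x)).
Proof. by move=> lf lg c x y; rewrite lg lf. Qed.

Lemma lin_mull (g : V -> H) a : lin g -> lin (fun x => g x * a).
Proof. by move=> lg c x y; rewrite lg mulrDl scalerAl. Qed.

Lemma lin_mulr (g : V -> H) a : lin g -> lin (fun x => a * g x).
Proof. by move=> lg c x y; rewrite lg mulrDr scalerAr. Qed.

Lemma lin_scaler (g : V -> W) (a : k) : lin g -> lin (fun x => a *: g x).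
Proof. by move=> lg c x y; rewrite lg scalerDr !scalerA mulrC. Qed.

Lemma lin_scalel (g : V -> k^o) (w : W) : lin g -> lin (fun x => (g x : k) *: w).
Proof. by move=> lg c x y; rewrite lg scalerDl -scalerA. Qed.

Lemma lin_sum (I : Type) (r : seq I) (F : V -> I -> W) :
  (forall i, lin (fun x => F x i)) -> lin (fun x => \sum_(i <- r) F x i).
Proof.
move=> lF c x y; rewrite scaler_sumr -big_split /=.
by apply: eq_bigr => i _; rewrite lF.
Qed.

Lemma lin_bilinl (F : H -> H -> V) (g : W -> H) b :
  bilin F -> lin g -> lin (fun x => F (g x) b).
Proof. by case=> F1 _ lg c x y; rewrite lg F1. Qed.

Lemma lin_bilinr (F : H -> H -> V) (g : W -> H) a :
  bilin F -> lin g -> lin (fun x => F a (g x)).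
Proof. by case=> _ F2 lg c x y; rewrite lg F2. Qed.

End LinearRules.

Section Calculus.
Variables (k : fieldType) (H : algType k).
Variables (D : H -> seq (H * H)) (e : H -> k) (S : H -> H).
Hypothesis hH : is_hopf D e S.

(* Sweedler notation: [sw F x] is the sum of the [F x_(1) x_(2)]. *)
Definition sw (A : zmodType) (F : H -> H -> A) x := \sum_(p <- D x) F p.1 p.2.

Lemma sw_ext (A : zmodType) (F G : H -> H -> A) x :
  (forall a b, F a b = G a b) -> sw F x = sw G x.
Proof. by move=> FG; apply: eq_bigr => p _. Qed.

Lemma sw_exchange (A : zmodType) (F : H -> H -> H -> H -> A) x y :
  sw (fun a b => sw (F a b) y) x = sw (fun c d => sw (fun a b => F a b c d) x) y.
Proof. exact: exchange_big. Qed.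

Lemma sw_teq (A : zmodType) (F : H -> H -> A) x t : balanced F ->
  teq (D x) t -> sw F x = \sum_(p <- t) F p.1 p.2.
Proof. by move=> bF /teq_tensor_eq; apply. Qed.

Lemma sw_balancedD (A : zmodType) (F : H -> H -> A) x y : balanced F ->
  sw F (x + y) = sw F x + sw F y.
Proof.
move=> bF; have := D_lin hH 1 x y; rewrite scale1r => /(sw_teq bF) ->.
by rewrite big_cat big_map /=; congr (_ + _); apply: eq_bigr => p _; rewrite scale1r.
Qed.

Lemma lin_S : lin S. Proof. exact: S_lin hH. Qed.

Lemma lin_e : lin (e : H -> k^o). Proof. exact: e_lin hH. Qed.

Lemma lin_sw (U W : lmodType k) (f : U -> W) (lf : lin f) (F : H -> H -> U) x :
  f (sw F x) = sw (fun a b => f (F a b)) x.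
Proof. by rewrite /sw (lin_suml lf). Qed.

Section Linear.
Variable V : lmodType k.

Lemma lin_swx (F : H -> H -> V) (g : H -> H) :
  bilin F -> lin g -> lin (fun x => sw F (g x)).
Proof.
move=> bF lg c x y; rewrite lg (sw_teq (bilin_balanced bF) (D_lin hH _ _ _)).
rewrite big_cat big_map /=; congr (_ + _).
by rewrite /sw scaler_sumr; apply: eq_bigr => p _; rewrite (linZ (bF.1 _)).
Qed.

Lemma lin_swF (W : lmodType k) (F : W -> H -> H -> V) z :
  (forall a b, lin (fun x => F x a b)) -> lin (fun x => sw (F x) z).
Proof. by move=> lF; apply: lin_sum => p; apply: lF. Qed.

Definition trilin (F : H -> H -> H -> V) :=
  [/\ forall b c, lin (fun x => F x b c), forall a c, lin (fun x => F a x c) &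
      forall a b, lin (F a b)].

(** Coassociativity is known for k-valued trilinear forms; linear functionals on [V] separate points
    and carry it over to values in [V]. *)
Lemma sw_coassoc (F : H -> H -> H -> V) x : trilin F ->
  sw (fun a b => sw (fun c d => F c d b) a) x =
  sw (fun a b => sw (fun c d => F a c d) b) x.
Proof.
move=> [F1 F2 F3]; apply: functionals_separate => phi lphi.
rewrite !(lin_sw lphi).
have tF : trilinear_form (fun a b c => phi (F a b c) : k).
  by split; [|split]=> c x' y' a b; rewrite (F1, F2, F3) lphi.
have := D_coass hH x tF; rewrite !big_flatten !big_map /= => E.
transitivity (\sum_(p <- D x) \sum_(q <- D p.1) phi (F q.1 q.2 p.2)).
  by apply: eq_bigr => p _; rewrite (lin_sw lphi).
transitivity (\sum_(p <- D x) \sum_(q <- D p.2) phi (F p.1 q.1 q.2)).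
  under eq_bigr do rewrite -(big_map (fun q => (q.1, q.2, _)) predT
    (fun r => phi (F r.1.1 r.1.2 r.2))).
  rewrite E; by apply: eq_bigr => p _; rewrite big_map.
by apply: eq_bigr => p _; rewrite (lin_sw lphi).
Qed.

Lemma sw_counitl (G : H -> V) x : lin G -> sw (fun a b => e a *: G b) x = G x.
Proof.
move=> lG; rewrite -[in RHS](counit_l hH x) (lin_suml lG).
by apply: eq_bigr => p _; rewrite (linZ lG).
Qed.

Lemma sw_counitr (G : H -> V) x : lin G -> sw (fun a b => e b *: G a) x = G x.
Proof.
move=> lG; rewrite -[in RHS](counit_r hH x) (lin_suml lG).
by apply: eq_bigr => p _; rewrite (linZ lG).
Qed.

Lemma sw_antipodel (G : H -> V) x : lin G -> sw (fun a b => G (S a * b)) x = e x *: G 1.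
Proof. by move=> lG; rewrite -(lin_sw lG) /sw (antipode_l hH) (linZ lG). Qed.

Lemma sw_antipoder (G : H -> V) x : lin G -> sw (fun a b => G (a * S b)) x = e x *: G 1.
Proof. by move=> lG; rewrite -(lin_sw lG) /sw (antipode_r hH) (linZ lG). Qed.

Lemma sw_mul (F : H -> H -> V) x y : bilin F ->
  sw F (x * y) = sw (fun a b => sw (fun c d => F (a * c) (b * d)) y) x.
Proof.
move=> bF; rewrite (sw_teq (bilin_balanced bF) (D_mul hH _ _)).
by rewrite big_allpairs_dep.
Qed.

Lemma sw_one (F : H -> H -> V) : bilin F -> sw F 1 = F 1 1.
Proof. by move=> bF; rewrite (sw_teq (bilin_balanced bF) (D_one hH)) big_seq1. Qed.

End Linear.
End Calculus.
Arguments lin_sw {k H D U W} f lf F x.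

(** Discharges the linearity side conditions of the Sweedler rules by following the syntax of the
    expression. *)
Ltac linear := lazymatch goal with
  | |- bilin _ => split; intro; cbn beta; linear
  | |- trilin _ => split; intros ? ?; cbn beta; linear
  | |- forall _, _ => intro; linear
  | |- lin _ => cbn beta; solve
     [ assumption | apply: lin_id
     | match goal with
       | h : bilin _ |- _ => exact: (h.1 _)
       | h : bilin _ |- _ => exact: (h.2 _)
       | h : bilin _ |- _ => apply: (lin_bilinl _ h); linear
       | h : bilin _ |- _ => apply: (lin_bilinr _ h); linear
       | h : lin _ |- _ => apply: (lin_comp h); linear
       | h : is_hopf _ _ _ |- _ => apply: (lin_comp (lin_S h)); linear
       | h : is_hopf _ _ _ |- _ => apply: (lin_comp (lin_e h)); linear
       | h : is_hopf _ _ _ |- _ => apply: (lin_swx h); linear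
       end
     | apply: lin_swF; linear
     | apply: lin_mull; linear | apply: lin_mulr; linear
     | apply: lin_scaler; linear | apply: lin_scalel; linear
     | apply: lin_sum; linear ]
  end.

(** * The antipode reverses products and coproducts *)

Section Antipode.
Variables (k : fieldType) (H : algType k).
Variables (D : H -> seq (H * H)) (e : H -> k) (S : H -> H).
Hypothesis hH : is_hopf D e S.
Local Notation sw := (sw D).

Lemma antipode1 : S 1 = 1.
Proof.
have := sw_antipodel hH 1 (@lin_id k H); rewrite (e_one hH) scale1r (sw_one hH); last linear.
by rewrite mulr1.
Qed.

(** Uniqueness of convolution inverses: S(x_1 y_1) x_2 y_2 S(y_3) S(x_3) collapses to the left side
    through the last factors and to the right side through the first ones. *)
Lemma antipodeM x y : S (x * y) = S y * S x.
Proof.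
have inner a b y' : sw (fun y1 y2 => sw (fun c d => S (a * c) * b * d * S y2) y1) y'
    = S (a * y') * b.
  transitivity (sw (fun y1 y2 => sw (fun c d => S (a * y1) * b * (c * S d)) y2) y').
    rewrite (sw_coassoc hH (F := fun u v w => S (a * u) * b * v * S w)); last linear.
    by apply: sw_ext => u v; apply: sw_ext => ? ?; rewrite !mulrA.
  transitivity (sw (fun y1 y2 => e y2 *: (S (a * y1) * b)) y').
    apply: sw_ext => u v.
    by rewrite (sw_antipoder hH (G := fun z => S (a * u) * b * z)) ?mulr1 //; linear.
  by rewrite (sw_counitr hH (G := fun u => S (a * u) * b)) //; linear.
transitivity (sw (fun x1 x2 => sw (fun a b => S (a * y) * b * S x2) x1) x).
  rewrite (sw_coassoc hH (F := fun u v w => S (u * y) * v * S w)); last linear.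
  transitivity (sw (fun u v => e v *: S (u * y)) x).
    by rewrite (sw_counitr hH (G := fun u => S (u * y))) //; linear.
  apply: sw_ext => u v.
  rewrite -[S (u * y) in LHS]mulr1 -(sw_antipoder hH (G := fun z => S (u * y) * z)); last linear.
  by apply: sw_ext => ? ?; rewrite mulrA.
transitivity (sw (fun x1 x2 => sw (fun y1 y2 =>
    sw (fun a b => sw (fun c d => S (a * c) * (b * d)) y1) x1 * S y2 * S x2) y) x).
  apply: sw_ext => x1 x2.
  transitivity (sw (fun a b => sw (fun y1 y2 =>
      sw (fun c d => S (a * c) * (b * d) * S y2 * S x2) y1) y) x1).
    apply: sw_ext => a b; rewrite -(inner a b y).
    rewrite (lin_sw (fun z => z * S x2)); last linear.
    apply: sw_ext => y1 y2; rewrite (lin_sw (fun z => z * S x2)); last linear.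
    by apply: sw_ext => c d; rewrite !mulrA.
  rewrite sw_exchange; apply: sw_ext => y1 y2.
  rewrite (lin_sw (fun z => z * S y2 * S x2)); last linear.
  apply: sw_ext => a b.
  by rewrite (lin_sw (fun z => z * S y2 * S x2)) //; linear.
(* The inner sums are the left antipode identity for the product [x1 * y1]. *)
transitivity (sw (fun x1 x2 => sw (fun y1 y2 => e x1 *: (e y1 *: (S y2 * S x2))) y) x).
  apply: sw_ext => x1 x2; apply: sw_ext => y1 y2.
  rewrite -(sw_mul hH (F := fun u v => S u * v)); last linear.
  rewrite (sw_antipodel hH _ (@lin_id k H)) (e_mul hH) -!scalerAl mul1r.
  by rewrite scalerA.
transitivity (sw (fun x1 x2 => e x1 *: (S y * S x2)) x).
  apply: sw_ext => x1 x2.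
  rewrite -(lin_sw (fun z => e x1 *: z)); last linear.
  by rewrite (sw_counitl hH (G := fun z => S z * S x2)) //; linear.
by rewrite (sw_counitl hH (G := fun z => S y * S z)) //; linear.
Qed.

(** Again convolution inverses, now of the comultiplication: Delta(S(x_1)) Delta(x_2) (S(x_4) (x)
    S(x_3)) is collapsed from either end. *)
Lemma sw_antipode (V : lmodType k) (F : H -> H -> V) x : bilin F ->
  sw F (S x) = sw (fun a b => F (S b) (S a)) x.
Proof.
move=> bF.
(* This is y_1 S(y_4) (x) y_2 S(y_3) = e(y) 1 (x) 1: the inner pair cancels before the outer one. *)
have inner (G : H -> H -> V) y : bilin G ->
  sw (fun y1 y2 => sw (fun a b => sw (fun c d => G (a * S d) (b * S c)) y2) y1) y
    = e y *: G 1 1.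
  move=> bG.
  rewrite (sw_coassoc hH
    (F := fun a b z => sw (fun c d => G (a * S d) (b * S c)) z)); last linear.
  transitivity (sw (fun a z => G (a * S z) 1) y); last first.
    by rewrite (sw_antipoder hH (G := fun z => G z 1)) //; linear.
  apply: sw_ext => a y2.
  rewrite -(sw_coassoc hH (F := fun b c d => G (a * S d) (b * S c))); last linear.
  transitivity (sw (fun u d => e u *: G (a * S d) 1) y2).
    apply: sw_ext => u d.
    by rewrite (sw_antipoder hH (G := fun z => G (a * S d) z)) //; linear.
  by rewrite (sw_counitl hH (G := fun d => G (a * S d) 1)) //; linear.
pose G u v z := sw (fun w1 w2 => F (u * S w2) (v * S w1)) z.
have bG z : bilin (fun u v => G u v z) by rewrite /G; linear.
pose K a b z := sw (fun u1 u2 => sw (fun v1 v2 => G (u1 * v1) (u2 * v2) z) b) (S a).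
transitivity (sw (fun x1 x2 => sw (fun b z => K x1 b z) x2) x); last first.
  rewrite -(sw_coassoc hH (F := K)); last by rewrite /K /G; linear.
  transitivity (sw (fun x1 x2 => e x1 *: sw (fun a b => F (S b) (S a)) x2) x); last first.
    by rewrite (sw_counitl hH (G := fun z => sw (fun a b => F (S b) (S a)) z)) //; linear.
  apply: sw_ext => x1 x2.
  transitivity (sw (fun a b => sw (fun u v => G u v x2) (S a * b)) x1).
    by apply: sw_ext => a b; rewrite (sw_mul hH) //.
  rewrite (sw_antipodel hH (G := fun z => sw (fun u v => G u v x2) z)); last first.
    by have := bG x2; linear.
  rewrite (sw_one hH) // /G; congr (_ *: _).
  by apply: sw_ext => a b; rewrite !mul1r.
transitivity (sw (fun x1 x2 => e x2 *: sw F (S x1)) x).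
  by rewrite (sw_counitr hH (G := fun z => sw F (S z))) //; linear.
apply: sw_ext => x1 x2; rewrite /K sw_exchange.
rewrite (lin_sw (fun z => e x2 *: z)); last linear.
apply: sw_ext => u1 u2.
rewrite -[u1 in LHS]mulr1 -[u2 in LHS]mulr1.
rewrite -(inner (fun u v => F (u1 * u) (u2 * v))); last linear.
apply: sw_ext => b z; apply: sw_ext => v1 v2; rewrite /G.
by apply: sw_ext => w1 w2; rewrite !mulrA.
Qed.

End Antipode.

(** * Subcoalgebras *)

Section Subcoalgebras.
Variables (k : fieldType) (H : algType k).
Variables (D : H -> seq (H * H)) (e : H -> k) (S : H -> H).
Hypothesis hH : is_hopf D e S.
Local Notation sw := (sw D).
Local Notation span := Defs.span.
Local Notation zero_space := (fun x : H => x = 0).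
Implicit Types (f g : H -> k^o) (C K : H -> Prop).

(* The two actions of the dual algebra on [H]: slices of the comultiplication. *)
Definition actr f x : H := sw (fun a b => (f b : k) *: a) x.
Definition actl f x : H := sw (fun a b => (f a : k) *: b) x.

Lemma lin_actr f : lin f -> lin (actr f).
Proof. by move=> lf; rewrite /actr; linear. Qed.

Lemma lin_actl f : lin f -> lin (actl f).
Proof. by move=> lf; rewrite /actl; linear. Qed.

Lemma actr_e x : actr e x = x.
Proof. by rewrite /actr (sw_counitr hH (G := fun z => z)) //; linear. Qed.

Lemma actl_e x : actl e x = x.
Proof. by rewrite /actl (sw_counitl hH (G := fun z => z)) //; linear. Qed.

(** Both sides pair Delta(x) with g (x) f. This transposition transfers stability of a subspace to
    its annihilator. *)
Lemma actr_actl f g x : lin f -> lin g -> f (actl g x) = g (actr f x).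
Proof.
move=> lf lg; rewrite /actl /actr (lin_sw _ lf) (lin_sw _ lg).
by apply: sw_ext => a b; rewrite (linZ lf) (linZ lg) [LHS]mulrC.
Qed.

Lemma actrA f g x : lin f -> lin g -> actr f (actr g x) = actr (fun y => f (actr g y)) x.
Proof.
move=> lf lg; rewrite [actr g x]/actr (lin_sw _ (lin_actr lf)).
transitivity (sw (fun a b => sw (fun c d => (f d : k) *: ((g b : k) *: c)) a) x).
  apply: sw_ext => a b; rewrite (linZ (lin_actr lf)) /actr.
  rewrite (lin_sw (fun z => (g b : k) *: z)); last linear.
  by apply: sw_ext => c d; rewrite !scalerA mulrC.
rewrite (sw_coassoc hH (F := fun c d b => (f d : k) *: ((g b : k) *: c))); last linear.
rewrite /actr; apply: sw_ext => a b; rewrite (lin_sw _ lf).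
rewrite (lin_sw (fun z : k^o => (z : k) *: a)); last linear.
by apply: sw_ext => c d; rewrite (linZ lf) -scalerA scalerA mulrC -scalerA.
Qed.

Lemma actlA f g x : lin f -> lin g -> actl f (actl g x) = actl (fun y => f (actl g y)) x.
Proof.
move=> lf lg; rewrite [actl g x]/actl (lin_sw _ (lin_actl lf)).
transitivity (sw (fun a b => sw (fun c d => (f c : k) *: ((g a : k) *: d)) b) x).
  apply: sw_ext => a b; rewrite (linZ (lin_actl lf)) /actl.
  rewrite (lin_sw (fun z => (g a : k) *: z)); last linear.
  by apply: sw_ext => c d; rewrite !scalerA mulrC.
rewrite -(sw_coassoc hH (F := fun a c d => (f c : k) *: ((g a : k) *: d))); last linear.
rewrite /actl; apply: sw_ext => a b; rewrite (lin_sw _ lf).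
rewrite (lin_sw (fun z : k^o => (z : k) *: b)); last linear.
by apply: sw_ext => c d; rewrite (linZ lf) -scalerA scalerA mulrC -scalerA.
Qed.

Lemma actl_actr f g x : lin f -> lin g -> actl f (actr g x) = actr g (actl f x).
Proof.
move=> lf lg; rewrite [actr g x]/actr [actl f x]/actl.
rewrite (lin_sw _ (lin_actl lf)) (lin_sw _ (lin_actr lg)).
transitivity (sw (fun a b => sw (fun c d => (g b : k) *: ((f c : k) *: d)) a) x).
  apply: sw_ext => a b; rewrite (linZ (lin_actl lf)) /actl.
  by rewrite (lin_sw (fun z => (g b : k) *: z)) //; linear.
rewrite (sw_coassoc hH (F := fun c d b => (g b : k) *: ((f c : k) *: d))); last linear.
apply: sw_ext => a b; rewrite (linZ (lin_actr lg)) /actr.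
rewrite (lin_sw (fun z => (f a : k) *: z)); last linear.
by apply: sw_ext => c d; rewrite !scalerA mulrC.
Qed.

Lemma D_in_actr C1 C2 f x : subsp C1 -> lin f -> D_in D C1 C2 x -> C1 (actr f x).
Proof.
move=> sC lf [t [Ct xt]]; rewrite /actr (sw_teq _ xt); last first.
  by apply: bilin_balanced; linear.
by apply: subsp_sum => // p /Ct[? _]; apply: subspZ.
Qed.

Lemma D_in_actl C1 C2 f x : subsp C2 -> lin f -> D_in D C1 C2 x -> C2 (actl f x).
Proof.
move=> sC lf [t [Ct xt]]; rewrite /actl (sw_teq _ xt); last first.
  by apply: bilin_balanced; linear.
by apply: subsp_sum => // p /Ct[_ ?]; apply: subspZ.
Qed.

(** [slice_fst] is applied twice: first to put the first components in [C1], then, after a swap, to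
    put the second ones in [C2] without leaving [C1]. *)
Lemma D_in_slices C1 C2 x : subsp C1 -> subsp C2 ->
  (forall f, lin f -> C1 (actr f x)) -> (forall f, lin f -> C2 (actl f x)) ->
  D_in D C1 C2 x.
Proof.
move=> s1 s2 h1 h2.
have sT : subsp (fun _ : H => True) by [].
have [|t1 t1D Ct1] := slice_fst (t := D x) s1 sT (C2 := fun=> True) _ h1; first by [].
have [||t2 t21 Ct2] := slice_fst (t := swap t1) s2 sT (C2 := C1).
- by move=> p /mapP[q /Ct1[[_ ?] _] ->].
- move=> f lf; rewrite big_map /= (t1D _ (fun a b => (f a : k) *: b)); first exact: h2.
  by apply: bilin_balanced; linear.
exists (swap t2); split; first by move=> p /mapP[q /Ct2[[_ ?] ?] ->].
apply: tensor_eq_teq => A F bF; rewrite -(t1D _ _ bF) -[t1]swapK.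
by symmetry; apply: tensor_eq_swap bF.
Qed.

(** Slice form of Delta(C) being contained in C (x) H: a subcomodule of the right comodule H. *)
Definition rcoideal C := subsp C /\ forall f x, lin f -> C x -> C (actr f x).

Lemma subcoalgebraP C : subcoalgebra D C <->
  rcoideal C /\ forall f x, lin f -> C x -> C (actl f x).
Proof.
split=> [[sC DC]|[[sC hr] hl]].
  split; [split=> // f x lf /DC|move=> f x lf /DC]; first exact: D_in_actr.
  exact: D_in_actl.
by split=> // x Cx; apply: D_in_slices => // f lf; auto.
Qed.

Lemma subsp_span (X : H -> Prop) : subsp (span X).
Proof.
split; first exact: sp_zero.
move=> c y z Xy Xz; elim: Xy => [|d u v Xu _ IH]; first by rewrite scaler0 add0r.
by rewrite scalerDr scalerA -addrA; apply: sp_comb.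
Qed.

Lemma span_in (X : H -> Prop) x : X x -> span X x.
Proof.
by move=> Xx; rewrite -[x]scale1r -[1 *: _]addr0; apply: sp_comb Xx (sp_zero _).
Qed.

(** The sub-bimodule generated by [x] over the dual algebra is a subcoalgebra; it contains [x] by
    the counit and is finite dimensional by coassociativity. *)
Lemma finite_subcoalgebra x :
  exists l : seq H, subcoalgebra D (adj zero_space l) /\ adj zero_space l x.
Proof.
pose X y := exists f g, [/\ lin f, lin g & y = actr f (actl g x)].
have sX := subsp_span X.
have stab (a : H -> H) : lin a -> (forall y, X y -> X (a y)) ->
    forall y, span X y -> span X (a y).
  move=> la Xa y; elim=> [|c u v Xu _ IH]; first by rewrite (lin0 la); apply: sp_zero.
  by rewrite la; apply: sp_comb => //; apply: Xa.
have coX : subcoalgebra D (span X).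
  apply/subcoalgebraP; split; first split=> // f y lf.
    apply: stab; first exact: lin_actr.
    move=> _ [f' [g [lf' lg ->]]]; exists (fun y => f (actr f' y)), g.
    by have := lin_actr lf'; rewrite actrA //; split=> //; linear.
  move=> f y lf; apply: stab; first exact: lin_actl.
  move=> _ [f' [g [lf' lg ->]]]; exists f', (fun y => f (actl g y)).
  by have := lin_actl lg; rewrite actl_actr // actlA //; split=> //; linear.
have Xx : span X x.
  by apply: span_in; exists e, e; rewrite actl_e actr_e; split=> //; apply: lin_e hH.
(* The middle components of x_1 (x) x_2 (x) x_3, which span every two-sided slice of [x]. *)
pose l := flatten [seq [seq q.1 | q <- D p.2] | p <- D x].
have s0 := subsp_zero H.
have sl := subsp_adj l s0.
have [||l' [Xl' _ _]] := adj_subspace (l := l) s0 sX.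
- by move=> y ->; apply: sp_zero.
- move=> y; elim=> [|c u v [f [g [lf lg ->]]] _ IH]; first exact: subsp0.
  apply: subspD => //; apply: subspZ => //.
  rewrite [actl g x]/actl (lin_sw _ (lin_actr lf)); apply: subsp_sum => // p px.
  rewrite (linZ (lin_actr lf)); apply: subspZ => //.
  apply: subsp_sum => // q qp; apply: subspZ => //; apply: adj_gen => //.
  by apply/flattenP; exists [seq q.1 | q <- D p.2]; apply: map_f.
exists l'; suff <- : span X = adj zero_space l' by [].
by apply/funext => y; apply/propext.
Qed.

Lemma adj_span l : adj zero_space l = span (fun y => y \in l).
Proof.
apply/funext => x; apply/propext; split.
  have sl := subsp_span (fun y => y \in l).
  apply: adj_min => // [y ->|y yl]; first exact: sp_zero.
  exact: span_in.
have sl := subsp_adj l (subsp_zero H).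
elim=> [|c u v ul _ IH]; first exact: subsp0.
by apply: subspD => //; apply: subspZ => //; apply: adj_gen => //; apply: subsp_zero.
Qed.

Lemma adj_add C l x : adj C l x <->
  exists y z, [/\ adj zero_space l y, C z & x = y + z].
Proof.
elim: l x => [|a l IH] x /=.
  by split=> [h|[_ [z [-> ? ->]]]]; [exists 0, x; rewrite add0r|rewrite add0r].
split=> [[c /IH[y [z [ly lz yz]]]]|[y [z [[c ly] lz ->]]]].
  exists (y + c *: a), z; split=> //; first by exists c; rewrite addrK.
  by rewrite addrAC -yz subrK.
by exists c; apply/IH; exists (y - c *: a), z; split=> //; rewrite addrAC.
Qed.

Lemma adj_cat l l' x : adj zero_space (l ++ l') x <->
  exists y z, [/\ adj zero_space l y, adj zero_space l' z & x = y + z].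
Proof.
suff <- : adj (adj zero_space l') l = adj zero_space (l ++ l') by apply: adj_add.
by elim: l => //= a l ->.
Qed.

Lemma subcoalgebra_cat l l' :
  subcoalgebra D (adj zero_space l) -> subcoalgebra D (adj zero_space l') ->
  subcoalgebra D (adj zero_space (l ++ l')).
Proof.
move=> /subcoalgebraP[[sl rl] ll] /subcoalgebraP[[sl' rl'] ll'].
apply/subcoalgebraP; split; first split.
- exact/subsp_adj/subsp_zero.
- move=> f x lf /adj_cat[y [z [ly lz ->]]]; apply/adj_cat.
  exists (actr f y), (actr f z); split; [exact: rl|exact: rl'|].
  by rewrite (linD (lin_actr lf)).
- move=> f x lf /adj_cat[y [z [ly lz ->]]]; apply/adj_cat.
  exists (actl f y), (actl f z); split; [exact: ll|exact: ll'|].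
  by rewrite (linD (lin_actl lf)).
Qed.

Lemma subsp_alg_gen (X : H -> Prop) : subsp (alg_gen X).
Proof.
split; first by rewrite -(scale0r 1); apply: ag_scale (ag_one X).
by move=> c x y Xx Xy; apply: ag_add => //; apply: ag_scale.
Qed.

Lemma alg_gen_sub (X Y : H -> Prop) : (forall x, X x -> alg_gen Y x) ->
  forall x, alg_gen X x -> alg_gen Y x.
Proof.
move=> XY x; elim=> {x} [x||x y _ Xx _ Xy|c x _ Xx|x y _ Xx _ Xy].
- exact: XY.
- exact: ag_one.
- exact: ag_add.
- exact: ag_scale.
- exact: ag_mul.
Qed.

Lemma D_in_scale_add K c x y : subsp K -> D_in D K K x -> D_in D K K y ->
  D_in D K K (c *: x + y).
Proof.
move=> sK Kx Ky; apply: D_in_slices => // f lf.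
  by rewrite (lin_actr lf); apply: subspD => //; first apply: subspZ => //;
    apply: D_in_actr; eassumption.
by rewrite (lin_actl lf); apply: subspD => //; first apply: subspZ => //;
  apply: D_in_actl; eassumption.
Qed.

Lemma D_in_mul K x y : (forall x y, K x -> K y -> K (x * y)) ->
  D_in D K K x -> D_in D K K y -> D_in D K K (x * y).
Proof.
move=> mK [s [Ks xs]] [t [Kt yt]].
exists [seq (p.1 * q.1, p.2 * q.2) | p <- s, q <- t]; split.
  by move=> _ /allpairsP[[p q] /= [/Ks[? ?] /Kt[? ?] ->]]; split; apply: mK.
apply: tensor_eq_teq => A F bF; have [F1 F2 F3] := bF.
rewrite [LHS](sw_teq bF (D_mul hH x y)) !big_allpairs_dep /=.
transitivity (\sum_(p <- D x) \sum_(q <- t) F (p.1 * q.1) (p.2 * q.2)).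
  apply: eq_bigr => p _.
  apply: (teq_tensor_eq yt (F := fun c d => F (p.1 * c) (p.2 * d))).
  split=> [a b c|a b c|c a b]; rewrite ?mulrDr ?F1 ?F2 //.
  by rewrite -scalerAr F3 scalerAr.
rewrite exchange_big [RHS]exchange_big; apply: eq_bigr => q _.
apply: (teq_tensor_eq xs (F := fun c d => F (c * q.1) (d * q.2))).
split=> [a b c|a b c|c a b]; rewrite ?mulrDl ?F1 ?F2 //.
by rewrite -scalerAl F3 scalerAl.
Qed.

Lemma D_in_sub C1 C2 K1 K2 x : (forall x, C1 x -> K1 x) -> (forall x, C2 x -> K2 x) ->
  D_in D C1 C2 x -> D_in D K1 K2 x.
Proof. by move=> h1 h2 [t [Ct xt]]; exists t; split=> // p /Ct[? ?]; split; auto. Qed.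

Lemma D_in_antipode C1 C2 x : D_in D C1 C2 x ->
  D_in D (fun y => exists2 z, C2 z & y = S z) (fun y => exists2 z, C1 z & y = S z) (S x).
Proof.
move=> [t [Ct xt]]; exists [seq (S p.2, S p.1) | p <- t]; split.
  by move=> _ /mapP[p /Ct[? ?] ->]; split; [exists p.2|exists p.1].
move=> F [F1 F2]; rewrite big_map.
have bF : bilin (F : H -> H -> k^o) by split=> z c y y'; rewrite (F1, F2).
rewrite [LHS](sw_antipode hH x bF) (sw_teq _ xt) //.
by apply: bilin_balanced; linear.
Qed.

Lemma hopf_sub_alg_gen (X : H -> Prop) :
  (forall x, X x -> D_in D (alg_gen X) (alg_gen X) x) ->
  (forall x, X x -> alg_gen X (S x)) -> hopf_sub D S (alg_gen X).
Proof.
have sX := subsp_alg_gen X; move=> DX SX; split=> //.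
- exact: ag_one.
- by move=> x y; apply: ag_mul.
- move=> x; elim=> {x} [x|||c x _ Xx|x y _ Xx _ Xy].
  + exact: SX.
  + by rewrite (antipode1 hH); apply: ag_one.
  + by move=> x y _ Xx _ Xy; rewrite (linD (lin_S hH)); apply: ag_add.
  + by rewrite (linZ (lin_S hH)); apply: ag_scale.
  + by rewrite (antipodeM hH); apply: ag_mul.
- have D1 : D_in D (alg_gen X) (alg_gen X) 1.
    exists [:: (1, 1)]; split; last exact: (D_one hH).
    by move=> p; rewrite inE => /eqP ->; split; apply: ag_one.
  have D0 : D_in D (alg_gen X) (alg_gen X) 0.
    by have := D_in_scale_add (-1) sX D1 D1; rewrite scaleN1r addNr.
  move=> x; elim=> {x} [x|||c x _ Xx|x y _ Xx _ Xy] //.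
  + exact: DX.
  + by move=> x y _ Xx _ Xy; rewrite -[x]scale1r; apply: D_in_scale_add.
  + by rewrite -[_ *: _]addr0; apply: D_in_scale_add.
  + by apply: D_in_mul => // u v; apply: ag_mul.
Qed.

End Subcoalgebras.

(** * Hopf subalgebras and left ideals *)

Section Descent.
Variables (k : fieldType) (H : algType k).
Variables (D : H -> seq (H * H)) (e : H -> k) (S : H -> H).
Hypothesis hH : is_hopf D e S.
Local Notation sw := (sw D).
Implicit Types K L : H -> Prop.
Implicit Types (a b : H).

(** The maps out of H (x)_K H, through which that tensor product is accessed. *)
Definition balanced_over K (A : zmodType) (F : H -> H -> A) :=
  [/\ forall x y z, F (x + y) z = F x z + F y z,
      forall z x y, F z (x + y) = F z x + F z y &
      forall x a y, K a -> F (x * a) y = F x (a * y)].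

Lemma hopf_sub_subsp K : hopf_sub D S K -> subsp K. Proof. by case. Qed.

Lemma balanced_over_scalars K (A : zmodType) (F : H -> H -> A) :
  hopf_sub D S K -> balanced_over K F -> balanced F.
Proof.
move=> hK [F1 F2 F3]; split=> // c x y.
have Kc : K (c *: 1) by apply: subspZ; [exact: hopf_sub_subsp hK|case: hK].
by have := F3 x _ y Kc; rewrite -scalerAl mul1r -scalerAr mulr1.
Qed.

(* [H K^+], as the intersection of the left ideals containing [K^+]. *)
Definition augmentation_ideal K x := forall J : H -> Prop, left_ideal J ->
  (forall y, K y -> e y = 0 -> J y) -> J x.

Lemma left_ideal_augmentation K : left_ideal (augmentation_ideal K).
Proof.
split; first by move=> J [].
split=> [x y Kx Ky J hJ KJ|h x Kx J hJ KJ].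
  by case: (hJ) => _ [JD _]; apply: JD; [apply: Kx|apply: Ky].
by case: (hJ) => _ [_ JM]; apply: JM; apply: Kx.
Qed.

(* [a (x) b |-> a_(1) (x) S(a_(2)) b] inverts the canonical map from
   [H (x)_K H] to [H/HK^+ (x) H]. *)
Lemma sw_augmentation_ideal K (A : zmodType) a : hopf_sub D S K ->
  augmentation_ideal K a -> forall (F : H -> H -> A) b, balanced_over K F ->
  sw (fun u v => F u (S v * b)) a = 0.
Proof.
move=> hK; have sK := hopf_sub_subsp hK.
have bS (F : H -> H -> A) b : balanced_over K F -> balanced (fun u v => F u (S v * b)).
  move=> bF; have [F1 F2 F3] := balanced_over_scalars hK bF.
  split=> [x y z|z x y|c x y]; first exact: F1.
    by rewrite (linD (lin_S hH)) mulrDl F2.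
  by rewrite F3 (linZ (lin_S hH)) scalerAl.
have F0 (F : H -> H -> A) x : balanced_over K F -> F x 0 = 0.
  by case=> _ F2 _; apply: (addrI (F x 0)); rewrite -F2 !addr0.
(* The coproduct of [y] lies in K (x) K, so y_1 may cross the tensor sign: y_1 (x) S(y_2) b = 1 (x)
   y_1 S(y_2) b = e(y) (1 (x) b). *)
have pos y : K y -> e y = 0 -> forall (F : H -> H -> A) b, balanced_over K F ->
    sw (fun u v => F u (S v * b)) y = 0.
  move=> Ky ey F b bF; have [_ _ _ _ /(_ y Ky)[t [Kt yt]]] := hK.
  rewrite (sw_teq (bS F b bF) yt).
  transitivity (\sum_(p <- t) F 1 (p.1 * S p.2 * b)).
    rewrite big_seq [RHS]big_seq; apply: eq_bigr => p /Kt[Kp _].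
    by case: bF => _ _ F3; rewrite -mulrA -(F3 1 p.1) // mul1r.
  have -> : \sum_(p <- t) F 1 (p.1 * S p.2 * b) = F 1 (\sum_(p <- t) p.1 * S p.2 * b).
    case: (bF) => _ F2 _; elim: (t) => [|p r IH]; first by rewrite !big_nil F0.
    by rewrite !big_cons F2 IH.
  rewrite -(teq_bilin (F := fun u v => u * S v * b) yt); last linear.
  have -> : \sum_(p <- D y) p.1 * S p.2 * b = e y *: (1 * b).
    by rewrite -(sw_antipoder hH y (G := fun z => z * b)) //; linear.
  by rewrite ey scale0r F0.
(* The elements killed for all [F] and [b] form a left ideal; left multiplication by h changes F to
   F(h_1 -, -) and b to S(h_2) b, hence the quantification over both. *)
move/(_ (fun a => forall (F : H -> H -> A) b, balanced_over K F ->
  sw (fun u v => F u (S v * b)) a = 0)); apply=> //; split; [|split].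
- apply: pos; first exact: subsp0.
  by rewrite (lin0 (lin_e hH)).
- move=> x y hx hy F b bF; rewrite (sw_balancedD hH _ _ (bS F b bF)).
  by rewrite hx // hy // addr0.
- move=> h y hy F b bF.
  rewrite (sw_teq (bS F b bF) (D_mul hH h y)) big_allpairs_dep /=.
  apply: big1 => p _; rewrite -[RHS](hy (fun u v => F (p.1 * u) v) (S p.2 * b)).
    by apply: eq_bigr => q _; rewrite (antipodeM hH) mulrA.
  case: bF => F1 F2 F3; split=> [u v z|z u v|u c v Kc].
  + by rewrite mulrDr F1.
  + exact: F2.
  + by rewrite mulrA F3.
Qed.

(** Evaluate a (x) b |-> a_1 (x) S(a_2) b on Delta(x) in two ways. The antipode gives x_1 (x) S(x_2)
    x_3 = x (x) 1. As x_1 can be taken in [L], it equals e(x_1) modulo HK^+, which gives 1 (x) x. *)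
Lemma augmentation_descent K L (A : zmodType) (F : H -> H -> A) x :
  hopf_sub D S K -> hopf_sub D S L ->
  (forall y, L y -> e y = 0 -> augmentation_ideal K y) ->
  balanced_over K F -> L x -> F 1 x = F x 1.
Proof.
move=> hK hL LK bKF Lx.
have bF := balanced_over_scalars hK bKF; have [F1 F2 F3] := bF.
pose G a b := sw (fun u v => F u (S v * b)) a.
have bS b : balanced (fun u v => F u (S v * b)).
  split=> [u v z|z u v|c u v]; first exact: F1.
    by rewrite (linD (lin_S hH)) mulrDl F2.
  by rewrite F3 (linZ (lin_S hH)) scalerAl.
have GD1 (a a' b : H) : G (a + a') b = G a b + G a' b by rewrite /G (sw_balancedD hH _ _ (bS b)).
have bG : balanced G.
  split=> // [z u v|c u v].
    by rewrite /G -big_split; apply: eq_bigr => p _; rewrite mulrDr F2.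
  have D0 : sw (fun u w => F u (S w * v)) 0 = 0.
    apply: (addrI (sw (fun u w => F u (S w * v)) 0)).
    by rewrite -(sw_balancedD hH _ _ (bS v)) !addr0.
  rewrite /G -[c *: u]addr0 (sw_teq (bS v) (D_lin hH _ _ _)) big_cat big_map /=.
  rewrite [X in _ + X]D0 addr0; apply: eq_bigr => p _.
  by rewrite F3 scalerAr.
have <- : sw G x = F x 1.
  have E : teq (flatten [seq [seq (q.1, S q.2 * p.2) | q <- D p.1] | p <- D x])
      [:: (x, 1)].
    move=> f [f1 f2]; rewrite big_flatten big_map big_seq1 /=.
    have bf : bilin (f : H -> H -> k^o) by split=> z c u v; rewrite (f1, f2).
    transitivity (sw (fun a b => sw (fun u v => (f u (S v * b) : k^o)) a) x).
      by apply: eq_bigr => p _; rewrite big_map.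
    rewrite (sw_coassoc hH (F := fun u v b => (f u (S v * b) : k^o))); last first.
      by have := bf; linear.
    transitivity (sw (fun a b => e b *: (f a 1 : k^o)) x).
      apply: sw_ext => a b.
      by rewrite (sw_antipodel hH (G := fun z => (f a z : k^o))) //; linear.
    by rewrite (sw_counitr hH (G := fun a => (f a 1 : k^o))) //; linear.
  have := teq_tensor_eq E bF; rewrite big_flatten big_map big_seq1 /= => <-.
  by apply: eq_bigr => p _; rewrite big_map.
have [_ _ _ _ /(_ x Lx)[t [Lt xt]]] := hL.
rewrite (sw_teq bG xt).
have G1 b : G 1 b = F 1 b.
  by rewrite /G (sw_teq (bS b) (D_one hH)) big_seq1 /= (antipode1 hH) mul1r.
have F0 : F 1 0 = 0 by apply: (addrI (F 1 0)); rewrite -F2 !addr0.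
transitivity (\sum_(p <- t) F 1 (e p.1 *: p.2)).
  rewrite -[in LHS](counit_l hH x).
  rewrite (teq_bilin (F := fun a b => e a *: b) xt); last linear.
  by elim: (t) => [|p r IH]; rewrite ?big_nil // !big_cons F2 IH.
rewrite big_seq [RHS]big_seq; apply: eq_bigr => p /Lt[Lp _].
(* Split [p.1] as e(p.1) plus an element of L^+; the latter lies in HK^+ and is killed by [G]. *)
have [_ _ bG3] := bG; rewrite -G1 -bG3 -[p.1 in RHS](subrK (e p.1 *: 1)) GD1.
rewrite [X in X + _](_ : _ = 0) ?add0r //.
apply: (sw_augmentation_ideal hK) => //; apply: LK.
  apply: subspB; [exact: hopf_sub_subsp hL|by []|].
  by apply: subspZ; [exact: hopf_sub_subsp hL|case: hL].
by rewrite (linB (lin_e hH)) (linZ (lin_e hH)) (e_one hH) [_ *: _]mulr1 subrr.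
Qed.

Definition descends K := forall x, (forall (A : zmodType) (F : H -> H -> A),
  balanced_over K F -> F 1 x = F x 1) -> K x.

Lemma augmentation_ideal_inj K L : hopf_sub D S K -> hopf_sub D S L -> descends K ->
  (forall x, augmentation_ideal L x -> augmentation_ideal K x) ->
  forall x, L x -> K x.
Proof.
move=> hK hL dK LK x Lx; apply: dK => A F bF.
apply: (augmentation_descent hK hL _ bF Lx) => y Ly ey; apply: LK.
by move=> J _; apply.
Qed.

(** If no member were all of H, dependent choice would give a strictly increasing sequence of
    members; its ideals HK^+ stabilise, against injectivity. *)
Lemma hopf_sub_acc (P : (H -> Prop) -> Prop) : left_noetherian H ->
  (exists K, P K) -> (forall K, P K -> hopf_sub D S K /\ descends K) ->
  (forall K x, P K -> exists L, [/\ P L, forall y, K y -> L y & L x]) ->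
  exists2 K, P K & forall x, K x.
Proof.
move=> noeth [K0 PK0] Phd Pext; apply: contrapT => none.
have step (K : {K | P K}) : exists L : {K | P K},
    (forall y, sval K y -> sval L y) /\ exists2 x, sval L x & ~ sval K x.
  have [x nKx] : exists x, ~ sval K x.
    apply: contrapT => all; apply: none; exists (sval K); first exact: (svalP K).
    by move=> x; apply: contrapT => nKx; apply: all; exists x.
  have [L [PL KL Lx]] := Pext _ x (svalP K).
  by exists (exist _ L PL); split=> //; exists x.
have [next nextP] := choice step.
pose K n := iter n next (exist _ K0 PK0).
have hK n := Phd _ (svalP (K n)).
have [n|n x Kx J hJ KJ|N stable] := noeth (fun n => augmentation_ideal (sval (K n))).
- exact: left_ideal_augmentation.
- by apply: Kx => // y Ky ey; apply: KJ => //; apply: (nextP (K n)).1.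
have [x Lx] := (nextP (K N)).2; apply.
have [hN dN] := hK N; have [hL _] := hK N.+1.
by apply: (augmentation_ideal_inj hN hL dN) Lx => y; apply: stable.
Qed.

End Descent.

(** * Faithful flatness *)

Section SubQuotient.
Variables (V : zmodType) (P : V -> Prop).
Hypothesis hP : P 0 /\ forall x y, P x -> P y -> P (x - y).

(** The closure proof is an argument so that the instance attached to [subgroup_pred hP] can be
    inferred from the term. *)
Definition subgroup_pred (_ : P 0 /\ forall x y, P x -> P y -> P (x - y)) : {pred V} :=
  fun x => `[< P x >].

Fact subgroup_pred_closed : GRing.zmod_closed (subgroup_pred hP).
Proof.
split; first by apply/asboolP; case: hP.
move=> x y /asboolP Px /asboolP Py; apply/asboolP; exact: hP.2.
Qed.

HB.instance Definition _ := GRing.isZmodClosed.Build V (subgroup_pred hP) subgroup_pred_closed.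

Lemma quotient_zmodule : exists (Q : zmodType) (pi : V -> Q),
  [/\ forall x y, pi (x + y) = pi x + pi y, forall x, pi x = 0 <-> P x &
      forall q, exists x, pi x = q].
Proof.
exists (Quotient.quot (subgroup_pred hP)), (\pi_(Quotient.quot (subgroup_pred hP)))%qT.
split=> [x y|x|q]; first exact: raddfD.
  have := Quotient.idealrBE (subgroup_pred hP) x 0; rewrite subr0.
  rewrite raddf0 => E; split=> [/eqP|Px]; first by rewrite -E => /asboolP.
  by apply/eqP; rewrite -E; apply/asboolP.
by exists (repr q); rewrite reprK.
Qed.

Record subgroup_type := SubGroup { subgroup_val : V; _ : subgroup_val \in subgroup_pred hP }.
HB.instance Definition _ := [isSub for subgroup_val].
HB.instance Definition _ := [Choice of subgroup_type by <:].
HB.instance Definition _ := [SubChoice_isSubZmodule of subgroup_type by <:].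

Lemma subgroup_zmodule : exists (N : zmodType) (iota : N -> V),
  [/\ forall x y, iota (x + y) = iota x + iota y, injective iota,
      forall n, P (iota n) & forall v, P v -> exists n, iota n = v].
Proof.
exists subgroup_type, val; split=> [//||[x /asboolP]//|v /asboolP Pv].
  exact: val_inj.
by exists (SubGroup Pv).
Qed.

End SubQuotient.

(** * Descent from faithful flatness, and generation from the chain condition *)

Section Generation.
Variables (k : fieldType) (H : algType k).
Variables (D : H -> seq (H * H)) (e : H -> k) (S : H -> H).
Hypothesis hH : is_hopf D e S.
Local Notation span := Defs.span.
Local Notation zero_space := (fun x : H => x = 0).
Implicit Types K L : H -> Prop.

(* If [1 (x) x = x (x) 1] in [H (x)_K H], then [1 (x) xbar = 0] in
   [H (x)_K H/K], so by flatness [H (x)_K K xbar = 0]. *)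
Lemma ff_right_descends K : hopf_sub D S K -> ff_right K -> descends K.
Proof.
move=> hK [flat faithful] x hx; have sK := hopf_sub_subsp hK.
have [_ K1 KM _ _] := hK.
have [|Q [pi [piD pi0 pi_surj]]] := @quotient_zmodule H K.
  by split=> [|u v]; [apply: subsp0|apply: subspB].
have pi_eq u v : K (u - v) -> pi u = pi v.
  by move=> /pi0 uv; rewrite -(subrK v u) piD uv add0r.
have eq_pi u v : pi u = pi v -> K (u - v).
  move=> uv; apply/pi0; apply: (addIr (pi v)).
  by rewrite -piD subrK uv add0r.
have [rep repK] := choice pi_surj.
(* An action must be a function on all of H; outside [K] it depends on the chosen representatives,
   but compatibility is needed only for scalars in [K]. *)
pose act' h q := pi (h * rep q).
have act'_pi a u : K a -> act' a (pi u) = pi (a * u).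
  move=> Ka; apply: pi_eq; rewrite -mulrBr; apply: KM => //.
  by apply: eq_pi; rewrite repK.
have mod' : lmod_over K act'.
  split=> [a n m Ka|a b n Ka Kb|a b n Ka Kb|n].
  - have [u <-] := pi_surj n; have [v <-] := pi_surj m.
    by rewrite -piD !act'_pi // mulrDr piD.
  - by rewrite /act' mulrDl piD.
  - by rewrite [act' b n]/act' act'_pi // /act' mulrA.
  - by rewrite /act' mul1r repK.
pose P q := exists2 a, K a & q = pi (a * x).
have [|N [iota [iotaD iota_inj iotaP iota_surj]]] := @subgroup_zmodule Q P.
  split; first by exists 0; [apply: subsp0|rewrite mul0r; apply/esym/pi0/(subsp0 sK)].
  move=> _ _ [a Ka ->] [b Kb ->]; exists (a - b); first exact: subspB.
  by apply: (addIr (pi (b * x))); rewrite subrK -piD -mulrDl subrK.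
(* A section of [iota] over the cyclic submodule generated by the class of [x], with default value 0
   elsewhere. *)
have [r rP] : exists r : Q -> N, forall q, P q -> iota (r q) = q.
  have : forall q, exists n, P q -> iota n = q.
    move=> q; have [/iota_surj[n nq]|nP] := pselect (P q); first by exists n.
    by exists 0.
  by move=> /choice[r rP]; exists r.
pose act h n := r (act' h (iota n)).
have iota_act a n : K a -> iota (act a n) = act' a (iota n).
  move=> Ka; apply: rP; have [b Kb ->] := iotaP n.
  by exists (a * b); rewrite ?act'_pi ?mulrA //; apply: KM.
have mod : lmod_over K act.
  case: mod' => m1 m2 m3 m4.
  split=> [a n m Ka|a b n Ka Kb|a b n Ka Kb|n]; apply: iota_inj.
  - by rewrite iotaD !iota_act // iotaD m1.
  - by rewrite iotaD !iota_act //; [rewrite m2|apply: subspD].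
  - by rewrite !iota_act ?m3 //; apply: KM.
  - by rewrite iota_act // m4.
have [n0 n0x] := iota_surj (pi x) (ex_intro2 _ _ 1 K1 (congr1 pi (esym (mul1r x)))).
(* After applying [iota], 1 (x) xbar equals x (x) 1bar by hypothesis, and 1bar = 0 in H/K; flatness
   brings this vanishing back to [N]. *)
have tz : tz_HN K act [:: (1, n0)].
  apply: (flat N Q act act' iota) => //.
  move=> A f f1 f2 f3; rewrite big_seq1 /= n0x.
  have /hx -> : balanced_over K (fun u v => f u (pi v)).
    by split=> [u v w|w u v|u a v Ka]; rewrite ?f1 // ?piD ?f2 // f3 // act'_pi.
  have -> : pi 1 = 0 by apply/pi0.
  by apply: (addrI (f x 0)); rewrite -f2 !addr0.
(* Each h (x) a n0 is ha times 1 (x) n0, hence zero, and faithfulness applies. *)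
have n00 : n0 = 0.
  apply: (faithful N act mod) => h n A f f1 f2 f3; rewrite big_seq1 /=.
  have [a Ka na] := iotaP n.
  have -> : n = act a n0 by apply: iota_inj; rewrite iota_act // n0x act'_pi.
  rewrite -f3 // -[h * a]mulr1.
  have := tz A (fun u m => f (h * a * u) m); rewrite big_seq1 /=; apply.
  - by move=> u v m; rewrite mulrDr f1.
  - by move=> *; apply: f2.
  - by move=> u b m Kb; rewrite mulrA f3.
apply/pi0; rewrite -n0x n00; apply: (addrI (iota 0)).
by rewrite -iotaD !addr0.
Qed.

Lemma alg_gen_hopf_sub K (X : H -> Prop) : hopf_sub D S K ->
  (forall x, X x -> K x) -> forall x, alg_gen X x -> K x.
Proof.
move=> hK XK x; have sK := hopf_sub_subsp hK; case: hK => _ K1 KM _ _.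
elim=> {x} [x||x y _ Xx _ Xy|c x _ Xx|x y _ Xx _ Xy] //.
- exact: XK.
- exact: subspD.
- exact: subspZ.
- exact: KM.
Qed.

Lemma locally_affine_affine : left_noetherian H -> locally_affine D S ->
  (forall K, hopf_sub D S K -> descends K) -> affine H.
Proof.
move=> noeth loc desc.
pose P K := hopf_sub D S K /\ exists t : seq H, (forall x, x \in t -> K x) /\
  forall x, K x -> alg_gen (fun y => y \in t) x.
have [|K [hK _]|K x [hK [t [tK Kt]]]|K [hK [t [_ Kt]]] KT] :=
    @hopf_sub_acc _ _ _ _ _ hH P noeth.
- by have [K [hK _ Kt]] := loc [::]; exists K.
- by split=> //; apply: desc.
- have [L [hL tL Lt]] := loc (x :: t); exists L; split=> //.
    move=> y /Kt; apply: alg_gen_hopf_sub => // z zt.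
    by apply: tL; rewrite inE zt orbT.
  by apply: tL; rewrite mem_head.
- by exists t => h; apply: Kt.
Qed.

Definition antipode_orbit (l : seq H) x :=
  exists (i : nat) (v : H), span (fun y => y \in l) v /\ x = iter i S v.

Lemma lin_iterS i : lin (iter i S).
Proof. by elim: i => [|i IH] c x y //=; rewrite IH (lin_S hH). Qed.

(** Since [S] reverses coproducts, the image of a subcoalgebra under each iterate of [S] is again
    one, and [S] sends each image to the next. *)
Lemma hopf_sub_antipode_orbit l : subcoalgebra D (adj zero_space l) ->
  hopf_sub D S (alg_gen (antipode_orbit l)).
Proof.
rewrite adj_span => -[_ Dl]; apply: (hopf_sub_alg_gen hH).
  move=> _ [i [v [lv ->]]].
  pose C i x := exists2 v, span (fun y => y \in l) v & x = iter i S v.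
  have : D_in D (C i) (C i) (iter i S v).
    elim: i => [|i IH].
      by apply: D_in_sub (Dl v lv) => x lx; exists x.
    by apply: D_in_sub (D_in_antipode hH IH) => _ [_ [w lw ->] ->]; exists w.
  by apply: D_in_sub => _ [w lw ->]; apply: ag_in; exists i, w.
by move=> _ [i [v [lv ->]]]; apply: ag_in; exists i.+1, v.
Qed.

Lemma noetherian_S_finite_type : left_noetherian H ->
  (forall K, hopf_sub D S K -> descends K) -> S_finite_type S.
Proof.
move=> noeth desc.
pose P K := exists2 l, subcoalgebra D (adj zero_space l) &
  K = alg_gen (antipode_orbit l).
have [|_ [l cl ->]|_ x [l cl ->]|_ [l _ ->] KT] := @hopf_sub_acc _ _ _ _ _ hH P noeth.
- have [l [cl _]] := finite_subcoalgebra hH 0.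
  by exists (alg_gen (antipode_orbit l)), l.
- by split; [|apply: desc]; apply: hopf_sub_antipode_orbit.
- have [l' [cl' lx]] := finite_subcoalgebra hH x.
  exists (alg_gen (antipode_orbit (l ++ l'))); split.
  + by exists (l ++ l') => //; apply: (subcoalgebra_cat hH).
  + apply: alg_gen_sub => _ [i [v [lv ->]]]; apply: ag_in; exists i, v; split=> //.
    rewrite -adj_span in lv; rewrite -adj_span; apply/adj_cat; exists v, 0.
    by split=> //; [apply: subsp0; apply: subsp_adj; apply: subsp_zero|rewrite addr0].
  + apply: ag_in; exists 0%N, x; split=> //; rewrite -adj_span; apply/adj_cat.
    exists 0, x; split=> //; last by rewrite add0r.
    by apply: subsp0; apply: subsp_adj; apply: subsp_zero.
- by exists l.
Qed.

(** H is spanned by the words in the letters S^i(l_j), and finite words over pairs of naturals are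
    countable. *)
Lemma S_finite_type_countable : S_finite_type S -> countable_dim H.
Proof.
move=> [l lT].
pose word (w : seq (nat * nat)) : H := \prod_(p <- w) iter p.1 S (nth 0 l p.2).
exists (fun n => if unpickle n is Some w then word w else 0) => h.
pose X x := exists w, x = word w.
set Y := (fun x => _).
have XY x : span X x -> span Y x.
  elim=> [|c u v [w ->] _ IH]; first exact: sp_zero.
  by apply: sp_comb => //; exists (pickle w); rewrite pickleK.
apply: XY; have sX := subsp_span X.
have X_in w : span X (word w) by apply: span_in; exists w.
elim: {h} (lT h) => [_ [i [v [lv ->]]]||x y _ Xx _ Xy|c x _ Xx|x y _ Xx _ Xy].
- elim: lv => [|c u w ul _ IH]; first by rewrite (lin0 (lin_iterS i)); apply: sp_zero.
  rewrite lin_iterS; apply: subspD => //; apply: subspZ => //.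
  have -> : iter i S u = word [:: (i, index u l)] by rewrite /word big_seq1 nth_index.
  exact: X_in.
- by have := X_in [::]; rewrite /word big_nil.
- exact: subspD.
- exact: subspZ.
- elim: Xx => [|c u v [w ->] _ IH]; first by rewrite mul0r; apply: sp_zero.
  rewrite mulrDl -scalerAl; apply: subspD => //; apply: subspZ => // {IH}.
  elim: Xy => [|d u' v' [w' ->] _ IH]; first by rewrite mulr0; apply: sp_zero.
  rewrite mulrDr -scalerAr; apply: subspD => //; apply: subspZ => //.
  by rewrite /word -big_cat; apply: X_in.
Qed.

End Generation.

(** * Pointed Hopf algebras *)

Section Pointed.
Variables (k : fieldType) (H : algType k).
Variables (D : H -> seq (H * H)) (e : H -> k) (S : H -> H).
Hypothesis hH : is_hopf D e S.
Hypothesis hpt : pointed D.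
Local Notation sw := (sw D).
Local Notation actr := (actr D).
Local Notation actl := (actl D).
Local Notation rcoideal := (rcoideal D).
Local Notation zero_space := (fun x : H => x = 0).
Implicit Types (M N C K : H -> Prop) (f : H -> k^o).

Definition grouplike g := teq (D g) [:: (g, g)] /\ e g = 1.

Lemma sw_grouplike (V : lmodType k) (F : H -> H -> V) g : bilin F -> grouplike g ->
  sw F g = F g g.
Proof. by move=> bF [gg _]; rewrite (sw_teq (bilin_balanced bF) gg) big_seq1. Qed.

Lemma grouplike_antipodel g : grouplike g -> S g * g = 1.
Proof.
move=> hg; have := sw_antipodel hH g (@lin_id k H).
by rewrite (sw_grouplike _ hg) ?hg.2 ?scale1r //; linear.
Qed.

Lemma grouplike_antipoder g : grouplike g -> g * S g = 1.
Proof.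
move=> hg; have := sw_antipoder hH g (@lin_id k H).
by rewrite (sw_grouplike _ hg) ?hg.2 ?scale1r //; linear.
Qed.

Lemma grouplike_antipode2 g : grouplike g -> S (S g) = g.
Proof.
move=> hg; rewrite -[RHS]mul1r -(antipode1 hH) -(grouplike_antipoder hg).
by rewrite (antipodeM hH) -mulrA grouplike_antipodel // mulr1.
Qed.

Lemma actr_grouplike f g : lin f -> grouplike g -> actr f g = (f g : k) *: g.
Proof. by move=> lf hg; rewrite /actr sw_grouplike //; linear. Qed.

(** If C = kx then Delta(x) = c x (x) x, so c x is the grouplike; the counit axiom gives e(c x) =
    1. *)
Lemma one_dim_grouplike C : subcoalgebra D C -> one_dim C -> exists2 g, C g & grouplike g.
Proof.
move=> [sC DC] [x [x0 xC]]; have Cx : C x by apply/xC; exists 1; rewrite scale1r.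
have [t [Ct xt]] := DC x Cx.
have [c tc] : exists c : k, tensor_eq t [:: (c *: x, x)].
  elim: t Ct {xt} => [|p t IH] Ct.
    exists 0 => A F bF; rewrite big_nil big_seq1 /= scale0r; symmetry.
    exact: balanced0l.
  have [|c tc] := IH; first by move=> q qt; apply: Ct; rewrite inE qt orbT.
  have [/xC[a pa] /xC[b pb]] := Ct p (mem_head _ _).
  exists (a * b + c) => A F bF; rewrite big_cons (tc _ _ bF) !big_seq1 /= pa pb.
  by case: bF => F1 F2 F3; rewrite scalerDl F1 mulrC -scalerA -(F3 b) scalerA mulrC -scalerA.
have xcx : teq (D x) [:: (c *: x, x)].
  by move=> f bf; rewrite (xt f bf) (tensor_eq_teq tc).
exists (c *: x); first by apply/xC; exists c.
split.
  move=> f [f1 f2]; rewrite big_seq1 /=.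
  have bf : bilin (f : H -> H -> k^o) by split=> z d u v; rewrite (f1, f2).
  have E : sw (f : H -> H -> k^o) (c *: x) = c *: sw (f : H -> H -> k^o) x.
    exact: (linZ (lin_swx hH bf (@lin_id k H))).
  rewrite [LHS]E.
  by rewrite (sw_teq (bilin_balanced bf) xcx) big_seq1 /= -(linZ (bf.2 _)).
have := counit_l hH x; rewrite (teq_bilin (F := fun a b => e a *: b) xcx); last first.
  by have := hH; linear.
rewrite big_seq1 /= => /eqP; rewrite -[X in _ == X]scale1r -subr_eq0 -scalerBl.
by rewrite scaler_eq0 (negbTE x0) orbF subr_eq0 => /eqP.
Qed.

(** Inside a finite-dimensional subcoalgebra containing [x], a minimal nonzero part of [C] exists;
    it is simple, hence one-dimensional. *)
Lemma pointed_grouplike C x : subcoalgebra D C -> C x -> x <> 0 ->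
  exists2 g, C g & grouplike g.
Proof.
move=> hC Cx x0; have [l [hl lx]] := finite_subcoalgebra hH x.
have sz := subsp_zero H.
pose CI y := C y /\ adj zero_space l y.
have hCI : subcoalgebra D CI.
  move/(subcoalgebraP _): hC => [[sC rC] lC]; move/(subcoalgebraP _): hl => [[sl rl] ll].
  apply/subcoalgebraP; split; first split; first exact: subspI.
    by move=> f y lf [? ?]; split; auto.
  by move=> f y lf [? ?]; split; auto.
have [|||||N [hN NCI _ [y Ny y0] minN]] :=
    @minimal_above _ _ (subcoalgebra D) zero_space CI l sz.
- by move=> N [].
- exact: hCI.
- by move=> y ->; case: hCI => -[].
- by exists x.
- by move=> y [].
have simpleN : simple_subcoalgebra D N.
  split=> //; first by exists y; split=> //; apply/eqP.
  move=> C' hC' C'N; case: (minN C') => //; [|by left|by right].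
  by move=> z ->; case: hC' => -[].
have [g Ng hg] := one_dim_grouplike hN (hpt simpleN).
by exists g => //; case: (NCI g Ng).
Qed.

(** * Coefficient coalgebras of subquotient comodules, and weight vectors *)

Section Coefficients.
Variables M V : H -> Prop.
Hypotheses (hM : rcoideal M) (hV : rcoideal V) (MV : forall x, M x -> V x).
Implicit Types Phi : seq (H -> k^o).

Fixpoint annihilators Phi : Prop :=
  if Phi is phi :: Phi' then
    [/\ lin phi, forall y, M y -> phi y = 0 & annihilators Phi'] else True.

(** Sums of terms phi(m_1) m_2, the matrix coefficients of the right comodule V/M. The functionals
    form a list so that a later proof can induct on their number. *)
Fixpoint coefficients Phi z : Prop :=
  if Phi is phi :: Phi' then exists2 m, V m & coefficients Phi' (z - actl phi m)
  else z = 0.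

Lemma subsp_coefficients Phi : annihilators Phi -> subsp (coefficients Phi).
Proof.
elim: Phi => [_|phi Phi IH [lphi _ /IH{}IH]] /=; first exact: subsp_zero.
split; first by exists 0; rewrite ?(lin0 (lin_actl hH lphi)) ?subr0;
  [apply: (subsp0 hV.1)|apply: (subsp0 IH)].
move=> c x y [m Vm xm] [n Vn yn]; exists (c *: m + n).
  by apply: (subspD hV.1); first apply: (subspZ hV.1).
rewrite (lin_actl hH lphi) opprD addrACA -scalerBr.
by case: IH => _; apply.
Qed.

Lemma coefficients_cat Phi Psi z : annihilators Phi -> annihilators Psi ->
  [/\ annihilators (Phi ++ Psi), coefficients Phi z -> coefficients (Phi ++ Psi) z &
      coefficients Psi z -> coefficients (Phi ++ Psi) z].
Proof.
elim: Phi z => [|phi Phi IH] z /= aPhi aPsi.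
  by split=> // ->; exact: (subsp0 (subsp_coefficients aPsi)).
have [lphi phiM {}aPhi] := aPhi.
split; first by split=> //; have [] := IH z aPhi aPsi.
  by move=> [m Vm zm]; exists m => //; have [_ h _] := IH (z - actl phi m) aPhi aPsi; apply: h.
move=> hz; exists 0; first exact: (subsp0 hV.1).
by rewrite (lin0 (lin_actl hH lphi)) subr0; have [_ _ h] := IH z aPhi aPsi; apply: h.
Qed.

Lemma coefficients_actr Phi f z : lin f -> annihilators Phi ->
  coefficients Phi z -> coefficients Phi (actr f z).
Proof.
move=> lf; elim: Phi z => [|phi Phi IH] z /=.
  by move=> _ ->; rewrite (lin0 (lin_actr hH lf)).
move=> [lphi _ aPhi] [m Vm zm]; exists (actr f m); first exact: hV.2.
by rewrite (actl_actr hH) // -(linB (lin_actr hH lf)); apply: IH.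
Qed.

(** Here the functionals change, from phi to f(actl phi -), which still kills [M] because [M] is a
    right coideal. Hence the coalgebra is the union over all lists. *)
Lemma coefficients_actl Phi f z : lin f -> annihilators Phi -> coefficients Phi z ->
  exists2 Psi, annihilators Psi & coefficients Psi (actl f z).
Proof.
move=> lf; elim: Phi z => [|phi Phi IH] z /=.
  by move=> _ ->; exists [::] => //=; rewrite (lin0 (lin_actl hH lf)).
move=> [lphi phiM aPhi] [m Vm /IH[//|Psi aPsi zm]].
have la := lin_actl hH lphi.
exists ((fun y => f (actl phi y)) :: Psi) => /=.
  split=> //; first by linear.
  by move=> y My; rewrite actr_actl // phiM //; apply: hM.2.
by exists m => //; rewrite -(actlA hH) // -(linB (lin_actl hH lf)).
Qed.

Lemma subcoalgebra_coefficients :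
  subcoalgebra D (fun z => exists2 Phi, annihilators Phi & coefficients Phi z).
Proof.
apply/(subcoalgebraP D); split; first split; first split.
- by exists [::].
- move=> c x y [Phi aPhi xP] [Psi aPsi yP].
  have [a h _] := coefficients_cat x aPhi aPsi.
  have [_ _ h'] := coefficients_cat y aPhi aPsi.
  exists (Phi ++ Psi) => //; have [_ s] := subsp_coefficients a.
  by apply: s; [apply: h|apply: h'].
- by move=> f x lf [Phi aPhi xP]; exists Phi => //; apply: coefficients_actr.
- by move=> f x lf [Phi aPhi xP]; apply: coefficients_actl lf aPhi xP.
Qed.

Lemma actl_annihilator phi v : lin phi -> (forall y, M y -> phi y = 0) -> M v ->
  actl phi v = 0.
Proof.
move=> lphi phiM Mv; apply: functionals_separate => f lf.
by rewrite (lin0 lf) actr_actl // phiM //; apply: hM.2.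
Qed.

(* When [V/M] is simple, every grouplike [g] of its coefficient coalgebra occurs
   as a weight of [V/M]: writing [g] with as few functionals as possible, the
   corresponding copies of [V/M] are independent, so a component of [g] is a
   weight vector. *)
Lemma simple_weight_vector g Phi z :
  (forall Q, rcoideal Q -> (forall x, M x -> Q x) -> (forall x, Q x -> V x) ->
     (forall x, Q x -> M x) \/ (forall x, V x -> Q x)) ->
  annihilators Phi -> coefficients Phi z -> z <> 0 ->
  (forall f, lin f -> actr f z = (f g : k) *: z) ->
  exists m, [/\ V m, ~ M m & forall f, lin f -> M (actr f m - (f g : k) *: m)].
Proof.
move=> simple; elim: Phi z => [|phi Phi IH] z //= [lphi phiM aPhi] [m Vm zm] z0 zg.
have sP := subsp_coefficients aPhi; have lap := lin_actl hH lphi.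
(* If the term of [phi] is expressible by [Phi] alone, the list can be shortened. *)
have drop : coefficients Phi (actl phi m) -> exists m, [/\ V m, ~ M m &
    forall f, lin f -> M (actr f m - (f g : k) *: m)].
  move=> hm; apply: (IH z) => //.
  by rewrite -(subrK (actl phi m) z); apply: subspD.
(* [Q] is a coideal between [M] and [V]: by simplicity, either [phi] is redundant on all of [V], or
   [Q] lies in [M] and the copy of V/M given by [phi] is independent of the others. *)
pose Q v := V v /\ coefficients Phi (actl phi v).
have hQ : rcoideal Q.
  split; first by apply: subspI; [exact: hV.1|apply: subsp_preim].
  move=> f v lf [Vv cv]; split; first exact: hV.2.
  by rewrite (actl_actr hH) //; apply: coefficients_actr.
have MQ v : M v -> Q v.
  move=> Mv; split; first exact: MV.
  by rewrite actl_annihilator //; apply: subsp0.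
have [v []//|QM|VQ] := simple Q hQ MQ; last by apply: drop; case: (VQ m Vm).
have [Mm|nMm] := pselect (M m).
  by apply: drop; rewrite actl_annihilator //; apply: subsp0.
(* The defect of [m] as a weight vector belongs to [Q]: [z] has weight [g], so applying [actl phi]
   leaves only the defect of the remaining terms [w], up to sign. *)
exists m; split=> // f lf; apply: QM; split.
  apply: (subspB hV.1); first exact: hV.2.
  exact: (subspZ hV.1).
set w := z - actl phi m in zm.
have -> : actl phi (actr f m - (f g : k) *: m) = - (actr f w - (f g : k) *: w).
  rewrite (linB lap) (linZ lap) (actl_actr hH) // /w (linB (lin_actr hH lf)) zg //.
  by rewrite scalerBr opprB [RHS]addrC opprB addrA subrK.
apply: subspN => //; apply: subspB => //; last exact: subspZ.
exact: coefficients_actr.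
Qed.

End Coefficients.

(** The conclusion says that the class of [m] in N/M has coaction m (x) g. Cutting [N] down to a
    finite-dimensional extension of [M] yields a simple V/M, and pointedness supplies a grouplike in
    its coefficient coalgebra. *)
Lemma pointed_weight_vector M N x : rcoideal M -> rcoideal N ->
  (forall y, M y -> N y) -> N x -> ~ M x ->
  exists m g, [/\ N m, ~ M m, grouplike g &
    forall f, lin f -> M (actr f m - (f g : k) *: m)].
Proof.
move=> hM hN MN Nx nMx.
have [l [/(subcoalgebraP D)[[sl rl] _] lx]] := finite_subcoalgebra hH x.
pose N0 y := N y /\ adj M l y.
have hN0 : rcoideal N0.
  split; first by apply: subspI; [exact: hN.1|exact: (subsp_adj _ hM.1)].
  move=> f y lf [Ny /adj_add[u [v [lu Mv yuv]]]]; split; first exact: hN.2.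
  apply/adj_add; exists (actr f u), (actr f v).
  by split; [exact: rl|exact: hM.2|rewrite yuv (linD (lin_actr hH lf))].
have [||||| V [hV VN0 MV [m0 Vm0 nMm0] minV]] :=
    @minimal_above _ _ rcoideal M N0 l hM.1.
- by move=> ? [].
- exact: hN0.
- by move=> y My; split; [exact: MN|exact: adj_sub].
- exists x => //; split=> //; apply/adj_add; exists x, 0.
  by rewrite addr0; split=> //; apply: (subsp0 hM.1).
- by move=> y [].
have [phi [lphi phiM phi1]] := separating_functional hM.1 nMm0.
(* The coefficient coalgebra is nonzero since e(actl phi m0) = phi(m0) = 1. *)
have [] := @pointed_grouplike _ (actl phi m0) (subcoalgebra_coefficients hM hV).
- by exists [:: phi] => //=; exists m0; rewrite ?subrr.
- move=> z0; have := actr_actl D m0 (lin_e hH) lphi.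
  rewrite z0 (lin0 (lin_e hH)) (actr_e hH) phi1 => /eqP.
  by rewrite eq_sym oner_eq0.
move=> g [Phi aPhi cg] hg.
have [|f lf|m [Vm nMm mg]] :=
    simple_weight_vector (g := g) hM hV MV minV aPhi cg.
- by move=> g0; have := hg.2; rewrite g0 (lin0 (lin_e hH)) => /eqP;
    rewrite eq_sym oner_eq0.
- exact: actr_grouplike.
by exists m, g; split=> //; case: (VN0 m Vm).
Qed.

(** * A right K-linear retraction onto a Hopf subalgebra *)

Section Retraction.
Variable K : H -> Prop.
Hypothesis hK : hopf_sub D S K.
Let sK : subsp K := hopf_sub_subsp hK.

Section WeightVector.
Variables (M : H -> Prop) (m g : H).
Hypotheses (hM : rcoideal M) (MK : forall x a, M x -> K a -> M (x * a)).
Hypotheses (hg : grouplike g)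
  (mg : forall f, lin f -> M (actr f m - (f g : k) *: m)).

(** Modulo M (x) H, the coproduct of m a is (m (x) g) Delta(a). *)
Lemma weight_vector_mul f a t : lin f -> tensor_eq t (D a) -> inC K K t ->
  M (actr f (m * a) - \sum_(p <- t) (f (g * p.2) : k) *: (m * p.1)).
Proof.
move=> lf ta Kt.
have -> : actr f (m * a) = \sum_(p <- t) actr (fun z => f (z * p.2)) m * p.1.
  have bF : bilin (fun u v => (f v : k) *: u) by linear.
  rewrite /actr (sw_mul hH _ _ bF) sw_exchange.
  rewrite [LHS](_ : _ = sw (fun c d => actr (fun z => f (z * d)) m * c) a).
    symmetry; apply: (ta _ (fun c d => actr (fun z => f (z * d)) m * c)).
    by apply: bilin_balanced; rewrite /actr; linear.
  apply: sw_ext => c d; rewrite /actr (lin_sw (fun z => z * c)); last linear.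
  by apply: sw_ext => u v; rewrite scalerAl.
rewrite -sumrB; apply: (subsp_sum hM.1) => p /Kt[Kp _].
rewrite scalerAl -mulrBl; apply: MK => //.
by apply: (mg (f := fun z => f (z * p.2))); linear.
Qed.

(* [a |-> m a] induces a Hopf-module map from [K] to [H/M], whose kernel is a
   Hopf submodule of [K], hence [0] or [K]. *)
Lemma weight_vector_free a : ~ M m -> K a -> M (m * a) -> a = 0.
Proof.
move=> nMm Ka Mma.
have [_ _ _ _ /(_ a Ka)[t0 [Kt0 at0]]] := hK.
have [t [tt0 ft Kt]] := reduce_snd sK Kt0.
have ta : tensor_eq t (D a).
  by move=> A F bF; rewrite (tt0 _ _ bF) (teq_tensor_eq at0 bF).
have Mt p : p \in t -> M (m * p.1).
  move=> pt; apply: mem_annihilator hM.1 _ => phi lphi phiM.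
  apply: (ft (fun z => phi (m * z))) pt; first by linear.
  apply: functionals_separate => f lf; rewrite (lin0 lf) (lin_suml lf).
  (* Translating [f] by the inverse [S g] cancels the weight [g], so independence of the second
     components forces each [m * p.1] into [M]. *)
  have lf' : lin (fun z => f (S g * z)) by linear.
  have := weight_vector_mul lf' ta Kt.
  have := hM.2 _ _ lf' Mma => Mact /(subspB hM.1 Mact); rewrite subKr => /phiM.
  rewrite (lin_suml lphi) => sum0; rewrite -[RHS]sum0; apply: eq_bigr => p' _.
  rewrite (linZ lf) (linZ lphi) mulrA grouplike_antipodel // mul1r.
  by rewrite [LHS]mulrC.
have [phi [lphi phiM phi1]] := separating_functional hM.1 nMm.
(* Because phi(m) = 1, a = phi(m a_1 S(a_2)) a_3; with m a_1 in [M] and [M] stable under [K], every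
   term vanishes. *)
transitivity (sw (fun u v => sw (fun c d => (phi (m * (u * S c)) : k) *: d) v) a).
  rewrite -(sw_coassoc hH (F := fun u c d => (phi (m * (u * S c)) : k) *: d)); last linear.
  transitivity (sw (fun u v => e u *: v) a).
    by rewrite (sw_counitl hH (G := fun z => z)) //; linear.
  apply: sw_ext => u v.
  rewrite (sw_antipoder hH (G := fun z => (phi (m * z) : k) *: v)); last linear.
  by rewrite mulr1 phi1 scale1r.
rewrite -[LHS](ta _ (fun u v => sw (fun c d => (phi (m * (u * S c)) : k) *: d) v)); last first.
  by apply: bilin_balanced; linear.
rewrite big_seq big1 // => p pt /=.
have [_ Kp2] := Kt p pt; have [_ _ _ KS /(_ _ Kp2)[t2 [Kt2 pt2]]] := hK.
rewrite (sw_teq _ pt2); last by apply: bilin_balanced; linear.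
rewrite big_seq big1 // => q /Kt2[Kq _]; rewrite mulrA phiM ?scale0r //.
by apply: MK; [exact: Mt|exact: KS].
Qed.

End WeightVector.

Definition sum_space (U C : H -> Prop) x := exists u a, [/\ U u, C a & x = u + a].

Lemma subsp_sum_space U C : subsp U -> subsp C -> subsp (sum_space U C).
Proof.
move=> sU sC; split; first by exists 0, 0; rewrite addr0; split=> //; apply: subsp0.
move=> c _ _ [u [a [Uu Ca ->]]] [v [b [Uv Cb ->]]].
exists (c *: u + v), (c *: a + b); split.
- by case: sU => _; apply.
- by case: sC => _; apply.
- by rewrite scalerDr addrACA.
Qed.

(* [H/K] is free over [K]: [U] is built by adjoining weight vectors [m]
   together with the free modules [m K]. *)
Lemma pointed_complement : exists U, [/\ subsp U,
  forall u a, U u -> K a -> U (u * a), forall u, U u -> K u -> u = 0 &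
  forall x, sum_space U K x].
Proof.
have [_ K1 KM KS KD] := hK.
have Kco f a : lin f -> K a -> K (actr f a).
  by move=> lf Ka; apply: D_in_actr sK lf (KD a Ka).
(* Only U + K is required to be a coideal: the vectors adjoined later are weight vectors modulo U +
   K, not modulo U. *)
pose P U := [/\ subsp U, forall u a, U u -> K a -> U (u * a),
  forall u, U u -> K u -> u = 0 &
  forall f u, lin f -> U u -> sum_space U K (actr f u)].
have [||U [[sU UK U0 Uco] _ maxU]] := @zorn_above H P (fun x => x = 0).
- split=> // [|u a -> _|f u lf ->]; first exact: subsp_zero.
    by rewrite mul0r.
  rewrite (lin0 (lin_actr hH lf)); exists 0, 0; rewrite addr0.
  by split=> //; apply: subsp0.
- move=> F F0 FP Ft; split.
  + by apply: subsp_chain => // A /FP[].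
  + by move=> u a [A FA Au] Ka; exists A => //; case: (FP A FA) => _ h _ _; apply: h.
  + by move=> u [A FA Au]; case: (FP A FA) => _ _ h _; apply: h.
  + move=> f u lf [A FA Au]; case: (FP A FA) => _ _ _ /(_ f u lf Au).
    by move=> [v [a [Av Ka ->]]]; exists v, a; split=> //; exists A.
exists U; split=> // x; apply: contrapT => nMx.
pose M := sum_space U K.
have sM : subsp M by apply: subsp_sum_space.
have UM u : U u -> M u.
  by move=> Uu; exists u, 0; rewrite addr0; split=> //; apply: subsp0.
have KMs a : K a -> M a.
  by move=> Ka; exists 0, a; rewrite add0r; split=> //; apply: subsp0.
have MK y a : M y -> K a -> M (y * a).
  move=> [u [b [Uu Kb ->]]] Ka; exists (u * a), (b * a).
  by split; [exact: UK|exact: KM|rewrite mulrDl].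
have hM : rcoideal M.
  split=> // f y lf [u [a [Uu Ka ->]]]; rewrite (linD (lin_actr hH lf)).
  by apply: (subspD sM); [exact: Uco|apply: KMs; exact: Kco].
have hT : rcoideal (fun=> True) by [].
have [|m [g [_ nMm hg mg]]] := @pointed_weight_vector M (fun=> True) x hM hT _ I nMx.
  by [].
have free := weight_vector_free hM MK hg mg nMm.
pose U' := sum_space U (fun y => exists2 a, K a & y = m * a).
have smK : subsp (fun y => exists2 a, K a & y = m * a).
  split; first by exists 0; [exact: subsp0|rewrite mulr0].
  move=> c _ _ [a Ka ->] [b Kb ->]; exists (c *: a + b); first by case: sK => _; apply.
  by rewrite mulrDr scalerAr.
have sU' : subsp U' by apply: subsp_sum_space.
have UU' u : U u -> U' u.
  by move=> Uu; exists u, 0; rewrite addr0; split=> //; apply: (subsp0 smK).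
have mU' a : K a -> U' (m * a).
  by move=> Ka; exists 0, (m * a); rewrite add0r; split=> //; [apply: subsp0|exists a].
(* Maximality would put [m] in [U]; it remains to check that U + mK is admissible. *)
apply: (nMm); apply: (UM); apply: (maxU U') => //; last first.
  by rewrite -[m]mulr1; apply: mU'.
have sU'K : subsp (sum_space U' K) by apply: subsp_sum_space.
have MU' y : M y -> sum_space U' K y.
  by move=> [u [a [Uu Ka ->]]]; exists u, a; split=> //; apply: UU'.
split=> //.
- move=> _ a [u [_ [Uu [b Kb ->] ->]]] Ka; rewrite mulrDl -mulrA.
  by apply: (subspD sU'); [apply: UU'; apply: UK|apply: mU'; apply: KM].
- move=> y [u [_ [Uu [b Kb ->] ->]]] Ky.
  (* An element of U + mK lying in [K] has its component m b in U + K, so freeness applies. *)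
  have b0 : b = 0.
    apply: free => //; rewrite -(addKr u (m * b)) addrC.
    by apply: (subspB sM); [exact: KMs|exact: UM].
  by move: Ky; rewrite b0 mulr0 addr0; apply: U0.
move=> f _ lf [u [_ [Uu [b Kb ->] ->]]]; rewrite (linD (lin_actr hH lf)).
apply: (subspD sU'K); first by apply: MU'; apply: Uco.
have [t [Kt bt]] := KD b Kb.
have tb : tensor_eq t (D b) by move=> A F bF; rewrite (teq_tensor_eq bt bF).
rewrite -(subrK (\sum_(p <- t) (f (g * p.2) : k) *: (m * p.1)) (actr f (m * b))).
apply: (subspD sU'K).
  by apply: MU'; apply: weight_vector_mul.
apply: (subsp_sum sU'K) => p /Kt[Kp _]; apply: (subspZ sU'K).
by exists (m * p.1), 0; rewrite addr0; split=> //; [apply: mU'|apply: subsp0].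
Qed.

(** The projection p onto [K] along [U] is right K-linear, so p(u) v is K-balanced; evaluating it on
    1 (x) x = x (x) 1 gives x = p(x). *)
Lemma pointed_descends : descends K.
Proof.
have [U [sU UK U0 UKT]] := pointed_complement; have [_ K1 KM _ _] := hK.
have [p pP] : exists p : H -> H, forall x, K (p x) /\ U (x - p x).
  have : forall x, exists a, K a /\ U (x - a).
    by move=> x; have [u [a [Uu Ka ->]]] := UKT x; exists a; rewrite addrK.
  by move=> /choice[p pP]; exists p.
have p_uniq x a : K a -> U (x - a) -> p x = a.
  move=> Ka Ua; have [Kp Up] := pP x; apply/eqP; rewrite -subr_eq0; apply/eqP.
  apply: U0; last exact: subspB.
  have -> : p x - a = (x - a) - (x - p x) by rewrite opprB [RHS]addrC subrKA.
  exact: subspB.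
move=> x hx.
have bF : balanced_over K (fun u v => p u * v).
  split=> [u v w|w u v|u a v Ka]; last 1 first.
  - rewrite mulrA; congr (_ * _); apply: p_uniq; first by apply: KM => //; case: (pP u).
    by rewrite -mulrBl; apply: UK => //; case: (pP u).
  - rewrite -mulrDl; congr (_ * _); have [Ku Uu] := pP u; have [Kv Uv] := pP v.
    by apply: p_uniq; [exact: subspD|rewrite opprD addrACA; exact: subspD].
  - by rewrite mulrDr.
have := hx H _ bF; rewrite mulr1 (p_uniq 1 1) //; last by rewrite subrr; apply: subsp0.
by rewrite mul1r => ->; case: (pP x).
Qed.

End Retraction.

Lemma alg_gen_finite (X : H -> Prop) y : alg_gen X y ->
  exists2 s : seq H, forall x, x \in s -> X x & alg_gen (fun x => x \in s) y.
Proof.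
have mono (s t : seq H) (z : H) : {subset s <= t} ->
    alg_gen (fun x => x \in s) z -> alg_gen (fun x => x \in t) z.
  by move=> st; apply: alg_gen_sub => x /st xt; apply: ag_in.
have catP (s t : seq H) : (forall x, x \in s -> X x) -> (forall x, x \in t -> X x) ->
    forall x, x \in s ++ t -> X x.
  by move=> sX tX x; rewrite mem_cat => /orP[/sX|/tX].
elim=> {y} [x Xx||x y _ [s sX sx] _ [t tX ty]|c x _ [s sX sx]|x y _ [s sX sx] _ [t tX ty]].
- exists [:: x]; first by move=> z; rewrite inE => /eqP ->.
  by apply: ag_in; rewrite mem_head.
- by exists [::] => //; apply: ag_one.
- exists (s ++ t); first exact: catP.
  apply: ag_add; [apply: mono sx|apply: mono ty] => z; rewrite mem_cat => ->//.
  exact: orbT.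
- by exists s => //; apply: ag_scale.
- exists (s ++ t); first exact: catP.
  apply: ag_mul; [apply: mono sx|apply: mono ty] => z; rewrite mem_cat => ->//.
  exact: orbT.
Qed.

Lemma alg_gen_finite_seq (X : H -> Prop) (l : seq H) :
  (forall x, x \in l -> alg_gen X x) ->
  exists2 s : seq H, forall x, x \in s -> X x &
    forall x, x \in l -> alg_gen (fun x => x \in s) x.
Proof.
elim: l => [|a l IH] lX; first by exists [::].
have [|s sX sl] := IH; first by move=> x xl; apply: lX; rewrite inE xl orbT.
have [t tX ta] := alg_gen_finite (lX a (mem_head _ _)).
exists (s ++ t); first by move=> x; rewrite mem_cat => /orP[/sX|/tX].
move=> x; rewrite inE => /orP[/eqP->|/sl].
  by apply: alg_gen_sub ta => y yt; apply: ag_in; rewrite mem_cat yt orbT.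
by apply: alg_gen_sub => y ys; apply: ag_in; rewrite mem_cat ys.
Qed.

(** * Local affineness of pointed Hopf algebras *)

Section GrouplikeInverses.
Variable C : H -> Prop.
Hypothesis hC : subcoalgebra D C.

Definition with_inverses x := C x \/ exists g, [/\ grouplike g, C g & x = S g].

(** Take a maximal coideal [M] of [C] whose antipode image lies in the algebra. A weight vector m of
    C/M has Delta(m) - m (x) g in M (x) C, so the antipode identity puts S(m) g, hence S(m), in the
    algebra, and [M] could be enlarged by m. *)
Lemma antipode_with_inverses x : C x -> alg_gen with_inverses (S x).
Proof.
move/(subcoalgebraP D): (hC) => [[sC rC] lC].
have sA := subsp_alg_gen with_inverses.
have sSA := subsp_preim (lin_S hH) sA.
pose P M := [/\ rcoideal M, forall x, M x -> C x &
  forall x, M x -> alg_gen with_inverses (S x)].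
have [||M [[hM MC MS] _ maxM]] := @zorn_above H P (fun x => x = 0).
- split=> [|y ->|y ->]; [|exact: subsp0|exact: subsp0 sSA].
  by split=> [|f y lf ->]; [exact: subsp_zero|rewrite (lin0 (lin_actr hH lf))].
- move=> F F0 FP Ft; split.
  + split; first by apply: subsp_chain => // A /FP[[]].
    by move=> f y lf [A FA Ay]; exists A => //; case: (FP A FA) => -[_ h] _ _; apply: h.
  + by move=> y [A FA Ay]; case: (FP A FA) => _ h _; apply: h.
  + by move=> y [A FA Ay]; case: (FP A FA) => _ _ h; apply: h.
move=> Cx; apply: (MS); apply: contrapT => nMx.
have [m [g [Cm nMm hg mg]]] := pointed_weight_vector hM (conj sC rC) MC Cx nMx.
have [phi [lphi phiM phi1]] := separating_functional hM.1 nMm.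
(* The weight is a coefficient of [m], and subcoalgebras contain their coefficients. *)
have Cg : C g.
  suff <- : actl phi m = g by apply: lC.
  apply: functionals_separate => f lf; rewrite actr_actl //.
  rewrite -(subrK ((f g : k) *: m) (actr f m)) (linD lphi) phiM ?add0r; last exact: mg.
  by rewrite (linZ lphi) phi1 [LHS]mulr1.
have [_ DC] := hC; have [t [Ct mt]] := DC m Cm.
(* The list represents Delta(m) - m (x) g; its slices are the weight defects of [m], which lie in
   [M]. *)
have slice f : lin f -> M (\sum_(p <- (- m, g) :: t) (f p.2 : k) *: p.1).
  move=> lf; rewrite big_cons /= scalerN addrC.
  suff <- : actr f m = \sum_(p <- t) (f p.2 : k) *: p.1 by apply: mg.
  by apply: (sw_teq _ mt); apply: bilin_balanced; linear.
have [|t' tt' Mt'] := slice_fst (C1 := C) (C2 := C) hM.1 sC _ slice.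
  move=> p; rewrite inE => /orP[/eqP -> /=|/Ct//].
  by split=> //; apply: subspN.
have Sm : alg_gen with_inverses (S m).
  have bF : bilin (fun u v => S u * v) by have := hH; linear.
  have E := tt' _ _ (bilin_balanced bF).
  rewrite big_cons /= (linN (lin_S hH)) -(teq_bilin mt bF) in E.
  rewrite (antipode_l hH) in E.
  rewrite -[S m]mulr1 -(grouplike_antipoder hg) mulrA; apply: ag_mul; last first.
    by apply: ag_in; right; exists g.
  have -> : S m * g = e m *: 1 - \sum_(p <- t') S p.1 * p.2.
    by rewrite E mulNr opprD opprK addrC subrK.
  apply: (subspB sA); first by apply: ag_scale; apply: ag_one.
  apply: (subsp_sum sA) => p /Mt'[[_ Mp] Cp]; apply: ag_mul; first exact: MS.
  by apply: ag_in; left.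
apply: nMm; apply: (maxM (fun y => exists c : k, M (y - c *: m))); last first.
- by exists 1; rewrite scale1r subrr; apply: subsp0 hM.1.
- by move=> y My; exists 0; rewrite scale0r subr0.
have sM' := subsp_adjoin m hM.1.
have dec y c : y = (y - c *: m) + c *: m by rewrite subrK.
split; first split=> //.
- move=> f y lf [c Mc]; exists (c * f g).
  rewrite [y in actr f y](dec y c) (linD (lin_actr hH lf)) (linZ (lin_actr hH lf)).
  rewrite -addrA -scalerA -scalerBr; apply: (subspD hM.1); first exact: hM.2.
  by apply: (subspZ hM.1); apply: mg.
- move=> y [c Mc]; rewrite (dec y c); apply: (subspD sC); first exact: MC.
  exact: subspZ.
- move=> y [c Mc]; rewrite (dec y c); apply: (subspD sSA); first exact: MS.
  exact: (subspZ sSA).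
Qed.

End GrouplikeInverses.

Lemma pointed_locally_affine : locally_affine D S.
Proof.
move=> s; have sz := subsp_zero H.
have [l [hl sl]] : exists l, subcoalgebra D (adj zero_space l) /\
    forall x, x \in s -> adj zero_space l x.
  elim: s => [|a s [l [hl sl]]].
    by have [l [hl _]] := finite_subcoalgebra hH 0; exists l.
  have [l' [hl' la]] := finite_subcoalgebra hH a.
  exists (l' ++ l); split; first exact: (subcoalgebra_cat hH).
  move=> x; rewrite inE => /orP[/eqP->|/sl lx]; apply/adj_cat.
    by exists a, 0; rewrite addr0; split=> //; apply: (subsp0 (subsp_adj l sz)).
  by exists 0, x; rewrite add0r; split=> //; apply: (subsp0 (subsp_adj l' sz)).
set C := adj zero_space l in hl sl.
(* Only finitely many elements of [C] and inverses occur in expressions for the antipodes of the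
   generators [l]; they are collected in [r]. *)
have [|r rX rl] := @alg_gen_finite_seq (with_inverses C) [seq S x | x <- l].
  by move=> _ /mapP[x xl ->]; apply: antipode_with_inverses => //; apply: adj_gen.
pose X x := x \in l ++ r.
have sK := subsp_alg_gen X.
have CK x : C x -> alg_gen X x.
  apply: adj_min => // [y ->|y yl]; first exact: subsp0.
  by apply: ag_in; rewrite /X mem_cat yl.
have SCK x : C x -> alg_gen X (S x).
  apply: (adj_min (subsp_preim (lin_S hH) sK)) => [y ->|y yl].
    by rewrite (lin0 (lin_S hH)); apply: subsp0.
  apply: (@alg_gen_sub _ _ (fun x => x \in r)); last by apply: rl; apply: map_f.
  by move=> z zr; apply: ag_in; rewrite /X mem_cat zr orbT.
have XP x : X x -> with_inverses C x.
  by rewrite /X mem_cat => /orP[xl|/rX//]; left; apply: adj_gen.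
exists (alg_gen X); split; last first.
- by exists (l ++ r); split=> // x xlr; apply: ag_in.
- by move=> x /sl/CK.
(* Stability under [S] closes up because the antipode of an inverse S(g) is g, which already lies in
   [C]. *)
apply: (hopf_sub_alg_gen hH) => [x Xx|x /XP[/SCK//|[g [hg Cg ->]]]]; last first.
  by rewrite grouplike_antipode2 //; apply: CK.
case: (XP x Xx) => [Cx|[g [hg Cg xg]]].
  by apply: D_in_sub (hl.2 x Cx).
have gg : D_in D (fun y => y = g) (fun y => y = g) g.
  by exists [:: (g, g)]; split; [move=> p; rewrite inE => /eqP ->|exact: hg.1].
rewrite xg; apply: D_in_sub (D_in_antipode hH gg) => _ [z -> ->]; exact: SCK.
Qed.

End Pointed.

Theorem theorem0p5 (k : closedFieldType) (hk : [pchar k] =i pred0)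
  (H : algType k) (D : H -> seq (H * H)) (e : H -> k) (S : H -> H)
  (hH : is_hopf D e S) (hnoeth : left_noetherian H) :
  (FF D S -> S_finite_type S /\ countable_dim H) /\
  (FF D S -> locally_affine D S -> affine H) /\
  (pointed D -> affine H).
Proof.
have FF_descends : FF D S -> forall K, hopf_sub D S K -> descends K.
  by move=> hFF K hK; apply: (ff_right_descends hK); case: (hFF K hK).
split; [|split].
- move=> hFF; have fin := noetherian_S_finite_type hH hnoeth (FF_descends hFF).
  by split=> //; apply: S_finite_type_countable hH fin.
- by move=> hFF loc; apply: (locally_affine_affine hH) (FF_descends hFF).
- move=> hpt; apply: (locally_affine_affine hH) => //.
    exact: pointed_locally_affine hH hpt.
  by move=> K hK; apply: (pointed_descends hH hpt hK).
Qed.
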